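(* Let $X$ be a uniformly locally finite metric space and assume that $\mathrm{C}^*_u(X)$ has no block-rank-one ghost projections. If $B\subseteq\mathrm{C}^*_u(X)$ is a Cartan masa isomorphic (as a $\mathrm{C}^*$-algebra) to $\ell_\infty(\mathbb N)$, then $B$ is co-separable in $\mathrm{C}^*_u(X)$.
   Context: A metric space $(X,d)$ is uniformly locally finite if for each $r>0$ there is $N$ such that every ball of radius $r$ has at most $N$ elements. $(\delta_x)_{x\in X}$ is the canonical basis of $\ell_2(X)$; for $A\subseteq X$, $\chi_A$ is the orthogonal projection onto $\ell_2(A)$. For $a\in\mathcal B(\ell_2(X))$ put $a_{x,z}=\langle a\delta_z,\delta_x\rangle$ and $\mathrm{prop}(a)=\sup\{d(x,y)\mid\langle a\delta_x,\delta_y\rangle\ne0\}$. The uniform Roe algebra $\mathrm{C}^*_u(X)$ is the norm closure in $\mathcal B(\ell_2(X))$ of the operators with finite propagation. $a\in\mathrm{C}^*_u(X)$ is a ghost if for all $\varepsilon>0$ there is a finite $A\subseteq X$ with $|a_{x,z}|\le\varepsilon$ for all $x,z\notin A$. A projection $p\in\mathrm{C}^*_u(X)$ is block-rank-one if there is a disjoint sequence $(X_n)_{n\in\mathbb N}$ of finite non-empty subsets of $X$ with $p=\sum_n\chi_{X_n}p\chi_{X_n}$ (convergence in the strong operator topology) and each $\chi_{X_n}p\chi_{X_n}$ of rank 1. Let $A$ be a unital $\mathrm{C}^*$-algebra. A $\mathrm{C}^*$-subalgebra $B\subseteq A$ is a Cartan masa in $A$ if: (i) $B$ is a maximal abelian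 self-adjoint subalgebra (masa) of $A$; (ii) $A$ is generated as a $\mathrm{C}^*$-algebra by the normalizer $N_A(B)=\{a\in A\mid aBa^*\cup a^*Ba\subseteq B\}$; (iii) there is a faithful conditional expectation $\Upsilon\colon A\to B$, i.e. a completely positive map with $\Upsilon(b)=b$ for $b\in B$, $\Upsilon(b_1ab_2)=b_1\Upsilon(a)b_2$ for $a\in A$, $b_1,b_2\in B$, and such that $\Upsilon(a^*a)=0$ implies $a=0$. A Cartan masa $B\subseteq\mathrm{C}^*_u(X)$ is co-separable if there is a countable $S\subseteq\mathrm{C}^*_u(X)$ such that $\mathrm{C}^*_u(X)$ is the $\mathrm{C}^*$-algebra generated by $B\cup S$. *)

(* Defs.v *)
From HB Require Import structures.
From mathcomp Require Import all_boot all_order all_algebra.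
From mathcomp Require Import complex finmap.
From mathcomp Require Import all_classical all_reals all_analysis.
From mathcomp.analysis.showcase Require summability.
From mathcomp Require Import ring.

Set Implicit Arguments.
Unset Strict Implicit.
Unset Printing Implicit Defensive.
Import Order.TTheory GRing.Theory Num.Theory.
Import numFieldNormedType.Exports.
Local Open Scope classical_set_scope.
Local Open Scope complex_scope.
Local Open Scope ring_scope.
Import Normc.

Section SquareSummable.
Context {R : realType} {X : choiceType}.
Implicit Types f g : X -> R[i].

Definition sqsum f : \bar R := \esum_(x in setT) ((normc (f x) ^+ 2)%:E).

Lemma sqsum_ge0 f : (0 <= sqsum f)%E.
Proof. by apply: esum_ge0 => x _; rewrite lee_fin sqr_ge0. Qed.

Lemma le_sqsumZ (k : R) (F : X -> R) : 0 <= k -> (forall x, 0 <= F x) ->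
  (\esum_(x in setT) (k * F x)%:E <= k%:E * \esum_(x in setT) (F x)%:E)%E.
Proof.
move=> k0 F0; apply: ge_ereal_sup => _ /= [A [finA _] <-].
under eq_fsbigr do rewrite EFinM.
rewrite -ge0_mule_fsumr; last by move=> x; rewrite lee_fin F0.
apply: lee_wpmul2l; first by rewrite lee_fin.
by apply: ereal_sup_ubound; exists A.
Qed.

Lemma sqsumZ (c : R[i]) f :
  (sqsum (c *: f)%R <= ((normc c) ^+ 2)%:E * sqsum f)%E.
Proof.
rewrite (le_trans _ (le_sqsumZ _ _))//; last 2 first.
- exact: sqr_ge0.
- by move=> x; exact: sqr_ge0.
by apply: le_esum => x _; rewrite lee_fin -exprMn -normcM.
Qed.

Lemma sqsumD f g (a b : R) : 0 < a -> 0 < b ->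
  (sqsum (f + g)%R <=
   ((a + b) / a)%R%:E * sqsum f + ((a + b) / b)%R%:E * sqsum g)%E.
Proof.
move=> a0 b0.
have ca : 0 <= (a + b) / a by rewrite divr_ge0// ltW// addr_gt0.
have cb : 0 <= (a + b) / b by rewrite divr_ge0// ltW// addr_gt0.
rewrite (le_trans _ (leeD (le_sqsumZ _ _) (le_sqsumZ _ _)))//; try by move=> *; exact: sqr_ge0.
rewrite -esumD; try by move=> x _; rewrite lee_fin mulr_ge0// sqr_ge0.
apply: le_esum => x _; rewrite -EFinD lee_fin.
have n0 z : 0 <= normc (z : R[i]) by case: z => u v; exact: sqrtr_ge0.
rewrite (@le_trans _ _ ((normc (f x) + normc (g x)) ^+ 2))//.
  by rewrite ler_sqr ?nnegrE ?addr_ge0 ?n0//; exact: le_normcD.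
move: (normc (f x)) (normc (g x)) => u v.
suff h : (a + b) / a * u ^+ 2 + (a + b) / b * v ^+ 2 =
   (u + v) ^+ 2 + (b * u - a * v) ^+ 2 / (a * b).
  by rewrite h lerDl divr_ge0 ?sqr_ge0// mulr_ge0 ?ltW.
by field; rewrite !gt_eqF.
Qed.

End SquareSummable.

Section L2.
Context (R : realType) (X : choiceType).

Definition square_summable : {pred X -> R[i]} :=
  fun f => `[< (sqsum f < +oo)%E >].

Lemma square_summable_submod : GRing.submod_closed square_summable.
Proof.
split.
  apply/asboolP; rewrite /sqsum esum1// => x _.
  by rewrite normc0 expr0n.
move=> c f g /asboolP ff /asboolP fg; apply/asboolP.
have cf : (sqsum (c *: f)%R < +oo)%E.
  apply: le_lt_trans (sqsumZ _ _) _.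
  by rewrite lte_mul_pinfty// lee_fin sqr_ge0.
apply: le_lt_trans (sqsumD _ _ ltr01 ltr01) _.
by rewrite lte_add_pinfty// lte_mul_pinfty// lee_fin divr_ge0.
Qed.
HB.instance Definition _ :=
  GRing.isSubmodClosed.Build _ _ square_summable square_summable_submod.

Record l2 := L2 { l2_fun :> X -> R[i]; l2_funP : l2_fun \in square_summable }.

HB.instance Definition _ := [isSub for l2_fun].
HB.instance Definition _ := gen_eqMixin l2.
HB.instance Definition _ := [Choice of l2 by <:].
HB.instance Definition _ := [SubChoice_isSubLmodule of l2 by <:].

Implicit Types f g : l2.
Definition l2norm f : R := Num.sqrt (fine (sqsum f)).

Lemma l2norm_ge0 f : 0 <= l2norm f. Proof. exact: sqrtr_ge0. Qed.

Lemma sqsum_l2norm f : sqsum f = (l2norm f ^+ 2)%:E.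
Proof.
have /asboolP foo := l2_funP f.
rewrite sqr_sqrtr ?fine_ge0 ?sqsum_ge0// fineK//.
by rewrite ge0_fin_numE ?sqsum_ge0.
Qed.

Lemma le_l2norm f (k : R) :
  0 <= k -> (sqsum f <= (k ^+ 2)%:E)%E -> l2norm f <= k.
Proof.
by move=> k0; rewrite sqsum_l2norm lee_fin ler_sqr// nnegrE// l2norm_ge0.
Qed.

Lemma l2norm_eq0 f : l2norm f = 0 -> f = 0.
Proof.
move=> f0; apply/val_inj/funext => x /=; apply: eq0_normc; apply/eqP.
rewrite -sqrf_eq0 eq_le sqr_ge0 andbT -lee_fin.
rewrite (@le_trans _ _ (sqsum f))//; last first.
  by rewrite sqsum_l2norm f0 expr0n.
apply: esum_ge; exists [set x]; first by split.
by rewrite fsbig_set1.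
Qed.

Lemma l2norm0 : l2norm 0 = 0.
Proof.
rewrite /l2norm /sqsum esum1 ?sqrtr0// => x _.
by congr EFin; apply/eqP; rewrite sqrf_eq0; apply/eqP; exact: normc0.
Qed.

Let normc_ge0 (c : R[i]) : 0 <= normc c.
Proof. by case: c => u v; exact: sqrtr_ge0. Qed.

Lemma l2normZ (c : R[i]) f : l2norm (c *: f) = normc c * l2norm f.
Proof.
have le_l2normZ (d : R[i]) g : l2norm (d *: g) <= normc d * l2norm g.
  apply: le_l2norm; first by rewrite mulr_ge0 ?l2norm_ge0.
  by rewrite (le_trans (sqsumZ _ _))// sqsum_l2norm -EFinM exprMn.
have [->|c0] := eqVneq c 0; first by rewrite scale0r l2norm0 normc0 mul0r.
apply/eqP; rewrite eq_le le_l2normZ/=.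
have nc0 : 0 < normc c.
  rewrite lt_neqAle normc_ge0 andbT eq_sym.
  by apply: contraNneq c0 => /eq0_normc ->.
rewrite -ler_pdivlMl// -normcV.
by rewrite -{1}[f]scale1r -(mulVf c0) -scalerA le_l2normZ.
Qed.

Lemma l2normD f g : l2norm (f + g) <= l2norm f + l2norm g.
Proof.
have [f0|f0] := eqVneq (l2norm f) 0.
  by rewrite (l2norm_eq0 f0) add0r l2norm0 add0r.
have [g0|g0] := eqVneq (l2norm g) 0.
  by rewrite (l2norm_eq0 g0) addr0 l2norm0 addr0.
have {}f0 : 0 < l2norm f by rewrite lt_neqAle eq_sym f0 l2norm_ge0.
have {}g0 : 0 < l2norm g by rewrite lt_neqAle eq_sym g0 l2norm_ge0.
apply: le_l2norm; first by rewrite addr_ge0 ?l2norm_ge0.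
rewrite (le_trans (sqsumD _ _ f0 g0))// !sqsum_l2norm -!EFinM -EFinD lee_fin.
rewrite le_eqVlt; apply/orP; left; apply/eqP.
by field; rewrite !gt_eqF.
Qed.

Let l2_normD f g : (l2norm (f + g))%:C <= (l2norm f)%:C + (l2norm g)%:C.
Proof. by rewrite -rmorphD lecR l2normD. Qed.

Let l2_normZ (c : R[i]) f : (l2norm (c *: f))%:C = `|c| * (l2norm f)%:C.
Proof. by rewrite l2normZ rmorphM. Qed.

Let l2_norm_eq0 f : (l2norm f)%:C = 0 -> f = 0.
Proof. by move=> /complexI/l2norm_eq0. Qed.

HB.instance Definition _ :=
  Lmodule_isNormed.Build R[i] l2 l2_normD l2_normZ l2_norm_eq0.

Lemma l2_normE f : `|f| = (l2norm f)%:C. Proof. by []. Qed.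

(* Unordered sum: the limit of the partial sums along the directed family of
   finite subsets of X. Linear on the left. *)
Definition l2dot f g : R[i] := @summability.sum X R[i] R[i]^o (fun x => f x * (g x)^*).

Fact l2_delta_subproof (x : X) : 
  (fun y => (y == x)%:R : R[i]) \in square_summable.
Proof.
apply/asboolP; rewrite (_ : sqsum _ = \esum_(y in [set x]) 1%:E).
  by rewrite esum_set1// ltry.
rewrite esum_mkcond; apply: eq_esum => y _.
have [->|yx] := eqVneq y x; first by rewrite mem_set// normc1 expr1n.
by rewrite memNset ?normc0 ?expr0n//; exact/eqP.
Qed.
Definition l2_delta (x : X) : l2 := L2 (l2_delta_subproof x).

Lemma l2dot_delta f (x : X) : l2dot f (l2_delta x) = f x.
Proof.
have FF := @summability.totally_filter X.
apply: (@cvg_lim R[i]^o); first exact: norm_hausdorff.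
apply: cvg_near_cst; exists [fset x]%fset => // A /= xA.
have Ax : x \in A by move/fsubsetP : xA; apply; rewrite inE.
rewrite /summability.partial_sum (bigD1 [` Ax]%fset)//= eqxx conjC1 mulr1.
rewrite big1 ?addr0// => y yx.
by rewrite (_ : (val y == x) = false) ?conjC0 ?mulr0//; exact/negbTE.
Qed.

Fact l2_chi_subproof (A : set X) f :
  (fun x => if x \in A then f x else 0) \in square_summable.
Proof.
have /asboolP foo := l2_funP f; apply/asboolP; apply: le_lt_trans foo.
apply: le_esum => x _; case: ifPn => // _.
by rewrite normc0 expr0n lee_fin sqr_ge0.
Qed.
Definition l2_chi (A : set X) f : l2 := L2 (l2_chi_subproof A f).

End L2.

Arguments l2_delta {R X} x.
Arguments l2_chi {R X} A f.

(* B(l2(X)) is the set [bounded_op] of functions H -> H, with the pointwise module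
   structure of function spaces, composition as product and [adj] as star.
   C*-algebras of operators are subsets of it. *)
Section Operators.
Context {R : realType} {X : choiceType}.
Local Notation H := (l2 R X).
Implicit Types (a b p : H -> H) (A B D M S : set (H -> H)).

Definition opnorm a : \bar R :=
  ereal_sup [set (l2norm (a f))%:E | f in [set f | l2norm f <= 1]].

Definition bounded_op a : Prop := linear a /\ (opnorm a < +oo)%E.

(* By the Riesz representation theorem, a bounded [a] has exactly one adjoint;
   the default value is only used for functions that are not operators. *)
Definition adj a : H -> H :=
  xget 0 [set b | bounded_op b /\ forall f g, l2dot (a f) g = l2dot f (b g)].

Definition projection p : Prop := [/\ bounded_op p, p \o p = p & adj p = p].

Definition norm_closure D : set (H -> H) :=
  [set a | bounded_op a /\
    forall e : R, 0 < e -> exists2 b, D b & (opnorm (a - b)%R < e%:E)%E].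

(* Subalgebras are not required to contain the identity operator. *)
Definition star_subalgebra D : Prop :=
  [/\ D `<=` bounded_op, D 0,
      forall (c : R[i]) a b, D a -> D b -> D (c *: a + b),
      forall a b, D a -> D b -> D (a \o b)
    & forall a, D a -> D (adj a)].

Definition cstar_subalgebra D : Prop :=
  star_subalgebra D /\ norm_closure D `<=` D.

Definition cstar_gen D : set (H -> H) := smallest cstar_subalgebra D.

Definition rank_one a : Prop :=
  exists2 v : H, v != 0 & range a = [set c *: v | c in [set: R[i]]].

Definition abelian D : Prop := forall a b, D a -> D b -> a \o b = b \o a.

(* [B] is maximal among all abelian self-adjoint subalgebras of [A], not only the
   norm-closed ones; the two readings agree. *)
Definition masa A B : Prop :=
  [/\ star_subalgebra B, B `<=` A, abelian B &
    forall M, star_subalgebra M -> M `<=` A -> abelian M -> B `<=` M -> M = B].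

Definition normalizer A B : set (H -> H) :=
  [set a | A a /\ forall b, B b -> B (a \o b \o adj a) /\ B (adj a \o b \o a)].

(* [T] is of the form c^* c in the *-algebra of n x n matrices over [D]. *)
Definition positive_mx D n (T : 'M[H -> H]_n) : Prop :=
  exists2 c : 'M[H -> H]_n, (forall i j, D (c i j)) &
    T = \matrix_(i, j) \sum_(k < n) (adj (c k i) \o c k j).

Definition completely_positive A B (Phi : (H -> H) -> (H -> H)) : Prop :=
  [/\ forall a, A a -> B (Phi a),
      forall (c : R[i]) a b, A a -> A b ->
        Phi (c *: a + b) = c *: Phi a + Phi b
    & forall n (T : 'M[H -> H]_n),
        positive_mx A T -> positive_mx B (map_mx Phi T)].

Definition faithful_expectation A B (Phi : (H -> H) -> (H -> H)) : Prop :=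
  [/\ completely_positive A B Phi,
      forall b, B b -> Phi b = b,
      forall b1 a b2, B b1 -> A a -> B b2 ->
        Phi (b1 \o a \o b2) = b1 \o Phi a \o b2
    & forall a, A a -> Phi (adj a \o a) = 0 -> a = 0].

Definition cartan_masa A B : Prop :=
  [/\ cstar_subalgebra B, masa A B, A = cstar_gen (normalizer A B) &
    exists Phi, faithful_expectation A B Phi].

Definition linfty : set (nat -> R[i]) :=
  [set u | exists k : R, forall n, `|u n| <= k%:C].

(* A *-isomorphism from the algebra of bounded sequences onto [B]; values of [Phi]
   on unbounded sequences are irrelevant. *)
Definition iso_linfty B : Prop :=
  exists Phi : (nat -> R[i]) -> (H -> H),
  [/\ set_bij linfty B Phi,
      forall (c : R[i]) u v, linfty u -> linfty v ->
        Phi (c *: u + v) = c *: Phi u + Phi v,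
      forall u v, linfty u -> linfty v -> Phi (u * v) = Phi u \o Phi v
    & forall u, linfty u -> Phi (fun n => (u n)^*) = adj (Phi u)].

Definition co_separable A B : Prop :=
  exists S, [/\ countable S, S `<=` A & A = cstar_gen (B `|` S)].

End Operators.

Section Roe.
Context {R : realType} {X : metricType R}.
Local Notation H := (l2 R X).
Implicit Types (a p : H -> H).

Definition uniformly_locally_finite : Prop :=
  forall r : R, 0 < r -> exists N, forall x : X, (ball x r #<= `I_N)%card.

(* The supremum of the empty set is -oo here, so the zero operator also has
   finite propagation. *)
Definition propagation a : \bar R :=
  ereal_sup [set (mdist z.1 z.2)%:E | z in
    [set z : X * X | l2dot (a (l2_delta z.1)) (l2_delta z.2) != 0]].

Definition uniform_roe : set (H -> H) :=
  norm_closure [set a | bounded_op a /\ (propagation a < +oo)%E].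

Definition entry a (x z : X) : R[i] := l2dot (a (l2_delta z)) (l2_delta x).

Definition ghost a : Prop :=
  uniform_roe a /\
  forall e : R, 0 < e -> exists2 A : set X, finite_set A &
    forall x z, ~ A x -> ~ A z -> `|entry a x z| <= e%:C.

Definition block_rank_one p : Prop :=
  [/\ uniform_roe p, projection p & exists X_ : nat -> set X,
    [/\ trivIset setT X_, forall n, finite_set (X_ n) /\ X_ n !=set0,
      forall f, (fun n => \sum_(k < n) l2_chi (X_ k) (p (l2_chi (X_ k) f)))
        @ \oo --> p f &
      forall n, rank_one (l2_chi (X_ n) \o p \o l2_chi (X_ n))]].

End Roe.

Arguments uniformly_locally_finite {R} X.
Arguments uniform_roe {R} X.

(* Main.v *)
Require Import Defs.
From HB Require Import structures.
From mathcomp Require Import all_boot all_order all_algebra.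
From mathcomp Require Import complex finmap.
From mathcomp Require Import all_classical all_reals all_analysis.
From mathcomp.analysis.showcase Require summability.
From mathcomp Require Import ring lra zify.

Set Implicit Arguments.
Unset Strict Implicit.
Unset Printing Implicit Defensive.
Import Order.TTheory GRing.Theory Num.Theory.
Import numFieldNormedType.Exports.
Local Open Scope classical_set_scope.
Local Open Scope complex_scope.
Local Open Scope ring_scope.
Import Normc.

(* The minimal projections of [B] have rank one because [B] is a masa containing them in an
   algebra with all rank one operators, and the faithful expectation makes their ranges span
   l2(X): [B] is the algebra of operators diagonal in an orthonormal basis [xi].  If the sup
   norms of the [xi n] were not bounded below, a subsequence could be perturbed to unit
   vectors [eta k] with disjoint finite supports, so slightly that the projection onto their
   span stays in the Roe algebra: a block-rank-one ghost projection.  So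
   [d <= |xi n (f n)|] for some [f] and [d > 0], and by Bessel's inequality [nat] splits into
   finitely many sets on which [f] is injective.  On each of them the partial isometry [W]
   sending [xi n] to the basis vector at [f n] is an average over signs of products of a
   multiplication operator and an element of [B]; by a Baire category argument the averaged
   operators are approximable with a uniform propagation, so [W] is in the Roe algebra.
   Finally [a] is the sum of the [W^* (W a)], [W a] is close to a finite sum of products
   [g V] of a multiplication operator and one of countably many generalized shifts, and
   [W^* g] is [b W^*] for some [b] in [B]. *)

(** Why intertwiners: the multiplication operators on [X] are too many for a countable set to
    supply, and they need not lie in [B]; moving them through the adjoint of an intertwiner lets [B]
    supply them.

    The obstacle is that an intertwiner is only a weak limit of averages over signs, while the Roe
    algebra is closed only in norm. A propagation bound does pass to weak limits, so it suffices to
    approximate all averages to a given precision with one bound. Each choice of signs comes with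
    its own bound; the category argument extracts a single bound valid on a dense set of signs
    inside one cylinder. Being approximable with fixed precision and fixed propagation is a convex
    condition, hence it survives averaging. The finitely many signs frozen by the cylinder spoil
    finitely many rows, which a finite rank operator repairs. *)

#[local] Arguments l2_fun : simpl never.

(** * Vectors of l2 and the inner product *)

#[local] Arguments l2_fun : simpl never.

Section Scalars.
Context {R : realType}.
Implicit Types z w : R[i].

Lemma normc_nonneg z : 0 <= normc z.
Proof. by case: z => a b; exact: sqrtr_ge0. Qed.

Lemma norm_normc z : `|z| = (normc z)%:C. Proof. by []. Qed.

Lemma normc_conj z : normc z^* = normc z.
Proof. by apply: complexI; exact: norm_conjC. Qed.

Lemma normc_real (x : R) : normc x%:C = `|x|.
Proof. by rewrite /normc /= expr0n addr0 sqrtr_sqr. Qed.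

Lemma mul_conj_normc z : z * z^* = ((normc z) ^+ 2)%:C.
Proof. by rewrite -normCK rmorphXn. Qed.

Lemma sqr_normcE z : normc z ^+ 2 = complex.Re z ^+ 2 + complex.Im z ^+ 2.
Proof. by case: z => a b /=; rewrite sqr_sqrtr// addr_ge0 ?sqr_ge0. Qed.

Lemma normc_sum (I : Type) (r : seq I) (F : I -> R[i]) :
  normc (\sum_(i <- r) F i) <= \sum_(i <- r) normc (F i).
Proof.
elim/big_rec2 : _ => [|i y z _ h]; first by rewrite normc0.
by rewrite (le_trans (le_normcD _ _))// lerD2l.
Qed.

Lemma Re_le_normc z : `|complex.Re z| <= normc z.
Proof. by rewrite -lecR; exact: normc_ge_Re. Qed.

Lemma Im_le_normc z : `|complex.Im z| <= normc z.
Proof.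
rewrite -(@ler_sqr R) ?nnegrE ?normc_nonneg// sqr_normcE real_normK ?num_real//.
by rewrite lerDr sqr_ge0.
Qed.

End Scalars.

Section L2Vectors.
Context {R : realType} {X : choiceType}.
Implicit Types (f g : l2 R X) (Y : {fset X}).

Lemma sqsum_le (f : X -> R[i]) (k : R) :
  (forall Y, \sum_(x <- Y) normc (f x) ^+ 2 <= k) -> (sqsum f <= k%:E)%E.
Proof.
move=> H; apply: ge_ereal_sup => _ /= [A [finA _] <-].
by rewrite fsbig_finite// sumEFin lee_fin.
Qed.

Lemma sum_sqr_le f Y : \sum_(x <- Y) normc (f x) ^+ 2 <= l2norm f ^+ 2.
Proof.
rewrite -lee_fin -sqsum_l2norm -sumEFin; apply: ereal_sup_ubound.
exists [set` Y]; first by split.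
by rewrite fsbig_finite// set_fsetK.
Qed.

(** Total, with value 0 on families that are not square summable. Operators can thus be defined by
    their coordinates first; [to_l2E] recovers the coordinates once the finite partial sums are
    bounded. *)
Definition to_l2 (f : X -> R[i]) : l2 R X := locked (insubd 0 f).

Lemma to_l2E (f : X -> R[i]) (k : R) :
  (forall Y, \sum_(x <- Y) normc (f x) ^+ 2 <= k) -> to_l2 f = f :> (X -> R[i]).
Proof.
move=> H; rewrite /to_l2 -lock; apply: (insubdK (0 : l2 R X)); apply/asboolP.
by rewrite (le_lt_trans (sqsum_le H))// ltry.
Qed.

Lemma l2norm_le_sum f (k : R) : 0 <= k ->
  (forall Y, \sum_(x <- Y) normc (f x) ^+ 2 <= k ^+ 2) -> l2norm f <= k.
Proof. by move=> k0 H; apply: le_l2norm => //; exact: sqsum_le. Qed.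

Lemma l2_ext f g : (forall x, f x = g x) -> f = g.
Proof. by move=> H; apply/val_inj/funext. Qed.

Lemma l2_addE f g x : (f + g) x = f x + g x. Proof. by []. Qed.
Lemma l2_scaleE (c : R[i]) f x : (c *: f) x = c * f x. Proof. by []. Qed.
Lemma l2_oppE f x : (- f) x = - f x. Proof. by []. Qed.
Lemma l2_subE f g x : (f - g) x = f x - g x. Proof. by []. Qed.
Lemma l2_sumE (I : Type) (r : seq I) (F : I -> l2 R X) x :
  (\sum_(i <- r) F i) x = \sum_(i <- r) F i x.
Proof. by elim/big_rec2 : _ => // i y z _ <-. Qed.

Lemma normc_le_l2norm f x : normc (f x) <= l2norm f.
Proof.
rewrite -(@ler_sqr R) ?nnegrE ?normc_nonneg ?l2norm_ge0//.
by have := sum_sqr_le f [fset x]%fset; rewrite big_seq_fset1.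
Qed.

Lemma l2normN f : l2norm (- f) = l2norm f.
Proof. by rewrite -scaleN1r l2normZ normcN normc1 mul1r. Qed.

Lemma l2normB f g : l2norm (f - g) <= l2norm f + l2norm g.
Proof. by rewrite -(l2normN g) l2normD. Qed.

Lemma l2normBC f g : l2norm (f - g) = l2norm (g - f).
Proof. by rewrite -l2normN opprB. Qed.

Lemma l2norm_sum (I : Type) (r : seq I) (F : I -> l2 R X) :
  l2norm (\sum_(i <- r) F i) <= \sum_(i <- r) l2norm (F i).
Proof.
elim/big_rec2 : _ => [|i y z _ h]; first by rewrite l2norm0.
by rewrite (le_trans (l2normD _ _))// lerD2l.
Qed.

Lemma l2_chiE (A : set X) f x : l2_chi A f x = if x \in A then f x else 0.
Proof. by []. Qed.

Lemma l2norm_chi (A : set X) f : l2norm (l2_chi A f) <= l2norm f.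
Proof.
apply: l2norm_le_sum; first exact: l2norm_ge0.
move=> Y; rewrite (le_trans _ (sum_sqr_le f Y))//; apply: ler_sum => x _.
by rewrite l2_chiE; case: ifP => // _; rewrite normc0 expr0n sqr_ge0.
Qed.

Lemma sum_fsetID (F : X -> R) Y Z :
  \sum_(x <- Y) F x = \sum_(x <- (Y `\` Z)%fset) F x + \sum_(x <- (Y `&` Z)%fset) F x.
Proof.
rewrite (big_fsetID _ (mem Z))/= addrC; congr (_ + _).
  by apply: eq_fbigl => x; rewrite !inE /= andbC.
by apply: eq_fbigl => x; rewrite !inE.
Qed.

Lemma le_sum_fset (F : X -> R) Y Z : (forall x, 0 <= F x) -> (Y `<=` Z)%fset ->
  \sum_(x <- Y) F x <= \sum_(x <- Z) F x.
Proof.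
move=> F0 YZ; rewrite (sum_fsetID _ Z Y) (fsetIidPr YZ).
by rewrite lerDr sumr_ge0.
Qed.

Lemma sum_fsetD_le (F : X -> R) Y Z : (forall x, 0 <= F x) ->
  \sum_(x <- Y) F x <= \sum_(x <- (Y `\` Z)%fset) F x + \sum_(x <- Z) F x.
Proof.
by move=> F0; rewrite (sum_fsetID _ Y Z) lerD2l le_sum_fset// fsubsetIr.
Qed.

(** A finite partial sum within [e ^+ 2] of the supremum leaves less than [e ^+ 2] for all other
    coordinates together. *)
Lemma l2_tail f (e : R) : 0 < e ->
  exists Y : {fset X}, forall Z, (Y `<=` Z)%fset -> l2norm (f - l2_chi [set` Z] f) <= e.
Proof.
move=> e0.
have [Y HY] : exists Y, l2norm f ^+ 2 - e ^+ 2 < \sum_(x <- Y) normc (f x) ^+ 2.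
  apply: contrapT => /forallNP H.
  have : (sqsum f <= (l2norm f ^+ 2 - e ^+ 2)%:E)%E.
    by apply: sqsum_le => Y; rewrite leNgt; apply/negP/H.
  by rewrite sqsum_l2norm lee_fin => h; have := exprn_gt0 2 e0; lra.
exists Y => Z /fsubsetP YZ; apply: l2norm_le_sum; first exact: ltW.
move=> W.
rewrite (@le_trans _ _ (\sum_(x <- (W `\` Y)%fset) normc (f x) ^+ 2))//; last first.
  have := sum_sqr_le f (W `|` Y)%fset.
  by rewrite (sum_fsetID _ _ Y) fsetUK fsetDUl fsetDv fsetU0; lra.
rewrite (le_trans (sum_fsetD_le _ Y _))// => [x|]; first exact: sqr_ge0.
rewrite (_ : \sum_(x <- Y) _ = 0) ?addr0; last first.
  apply: big1_seq => x /andP[_ xY]; rewrite l2_subE l2_chiE mem_set/= ?YZ//.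
  by rewrite subrr normc0 expr0n.
apply: ler_sum => x _; rewrite l2_subE l2_chiE; case: ifP => _; last by rewrite subr0.
by rewrite subrr normc0 expr0n sqr_ge0.
Qed.

Lemma l2norm_eq_chi_fset f Y : l2norm (l2_chi [set` Y] f) ^+ 2 = \sum_(x <- Y) normc (f x) ^+ 2.
Proof.
apply/eqP; rewrite eq_le; apply/andP; split; last first.
  rewrite (le_trans _ (sum_sqr_le _ Y))// le_eqVlt; apply/orP; left; apply/eqP.
  by apply: eq_big_seq => x xY; rewrite l2_chiE mem_set.
have s0 : 0 <= \sum_(x <- Y) normc (f x) ^+ 2 by apply: sumr_ge0 => x _; exact: sqr_ge0.
rewrite -[leRHS]sqr_sqrtr// ler_sqr ?nnegrE ?l2norm_ge0 ?sqrtr_ge0//.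
apply: l2norm_le_sum; rewrite ?sqrtr_ge0// => Z; rewrite sqr_sqrtr//.
rewrite (le_trans (sum_fsetD_le _ Y _))// => [x|]; first exact: sqr_ge0.
rewrite big1_seq ?add0r => [|x /andP[_ /[!inE]/andP[/negP xY _]]]; last first.
  by rewrite l2_chiE memNset ?normc0 ?expr0n.
apply: ler_sum => x _; rewrite l2_chiE; case: ifP => // _.
by rewrite normc0 expr0n sqr_ge0.
Qed.

End L2Vectors.

Lemma cvg_sum_seq (K : numFieldType) (V : normedModType K) (T I : Type)
    (F : set_system T) {FF : Filter F} (r : seq I)
    (u : I -> T -> V) (l : I -> V) : (forall i, u i @ F --> l i) ->
  (fun t => \sum_(i <- r) u i t) @ F --> \sum_(i <- r) l i.
Proof.
move=> H; elim: r => [|i r IH].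
  rewrite big_nil; under eq_fun do rewrite big_nil; exact: cvg_cst.
rewrite big_cons; under eq_fun do rewrite big_cons.
exact: cvgD (H i) IH.
Qed.

Section InnerProduct.
Context {R : realType} {X : choiceType}.
Implicit Types (f g h : l2 R X) (Y : {fset X}) (c : R[i]).
Local Notation psum f g :=
  (@summability.partial_sum X R[i]^o (fun x => f x * (g x)^*)).

#[local] Instance totally_properfilter : ProperFilter (@summability.totally X) :=
  @summability.totally_filter X.

Lemma psumE f g Y : psum f g Y = \sum_(x <- Y) f x * (g x)^*.
Proof. by rewrite /summability.partial_sum [RHS]big_seq_fsetE. Qed.

Lemma psum_self f : psum f f @ summability.totally --> ((l2norm f ^+ 2)%:C : R[i]^o).
Proof.
apply/(@cvgrPdist_le R[i] R[i]^o) => e e0.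
have [r r0 er] : exists2 r : R, 0 < r & e = r%:C.
  exists (complex.Re e); last by rewrite RRe_real// gtr0_real.
  by move: e0; rewrite ltcE/= => /andP[].
rewrite {e e0}er; have [Y HY] : exists Y, l2norm f ^+ 2 - r < \sum_(x <- Y) normc (f x) ^+ 2.
  apply: contrapT => /forallNP H.
  have : (sqsum f <= (l2norm f ^+ 2 - r)%:E)%E.
    by apply: sqsum_le => Y; rewrite leNgt; apply/negP/H.
  by rewrite sqsum_l2norm lee_fin => h; lra.
exists Y => // Z /= YZ.
have -> : psum f f Z = (\sum_(x <- Z) normc (f x) ^+ 2)%:C.
  by rewrite psumE rmorph_sum; apply: eq_bigr => x _; exact: mul_conj_normc.
rewrite -rmorphB norm_normc lecR normc_real.
have := sum_sqr_le f Z; have := le_sum_fset (fun x => sqr_ge0 (normc (f x))) YZ.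
by move=> h1 h2; rewrite ger0_norm; lra.
Qed.

Lemma polarization (z w : R[i]) : z * w^* =
  4^-1 * \sum_(k < 4) 'i ^+ k * ((z + 'i ^+ k * w) * (z + 'i ^+ k * w)^*).
Proof.
rewrite !big_ord_recr big_ord0 /= !expr0 !expr1 !exprS expr0.
have i2 : 'i * 'i = -1 :> R[i] by rewrite -expr2 sqrCi.
rewrite !mulr1 !i2 !rmorphD !rmorphM !rmorphN /= conjCi.
rewrite ?conjC1; by field: i2.
Qed.

(* Polarization turns the convergence of the sums defining [l2dot] into that of norms. *)
Definition dotp f g : R[i] :=
  4^-1 * \sum_(k < 4) 'i ^+ k * (l2norm (f + 'i ^+ k *: g) ^+ 2)%:C.

Lemma psum_cvg f g : psum f g @ summability.totally --> (dotp f g : R[i]^o).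
Proof.
have -> : psum f g = (fun Y => 4^-1 *
    \sum_(k < 4) 'i ^+ k * psum (f + 'i ^+ k *: g) (f + 'i ^+ k *: g) Y).
  apply/funext => Y; rewrite psumE.
  under eq_bigr do rewrite polarization.
  rewrite -mulr_sumr exchange_big; congr (_ * _); apply: eq_bigr => k _.
  by rewrite psumE mulr_sumr.
apply: (@cvgMl_tmp R[i]); apply: (@cvg_sum_seq R[i] R[i]^o) => k.
by apply: (@cvgMl_tmp R[i]); exact: psum_self.
Qed.

Lemma l2dot_unique f g (l : R[i]) :
  psum f g @ summability.totally --> (l : R[i]^o) -> l2dot f g = l.
Proof. by move=> H; apply: (@cvg_lim R[i]^o) => //; exact: norm_hausdorff. Qed.

(** [l2dot] is a [lim], which carries no information unless the partial sums converge. The algebraic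
    rules below transport those of finite sums through this convergence. *)
Lemma l2dot_cvg f g : psum f g @ summability.totally --> (l2dot f g : R[i]^o).
Proof. by rewrite (l2dot_unique (@psum_cvg f g)); exact: psum_cvg. Qed.

Lemma l2dotDl f g h : l2dot (f + g) h = l2dot f h + l2dot g h.
Proof.
apply: l2dot_unique.
have -> : psum (f + g) h = (fun Y => psum f h Y + psum g h Y).
  apply/funext => Y; rewrite !psumE -big_split; apply: eq_bigr => x _.
  by rewrite l2_addE mulrDl.
exact: (@cvgD R[i] R[i]^o) (@l2dot_cvg f h) (@l2dot_cvg g h).
Qed.

Lemma l2dotZl c f h : l2dot (c *: f) h = c * l2dot f h.
Proof.
apply: l2dot_unique.
have -> : psum (c *: f) h = (fun Y => c * psum f h Y).
  apply/funext => Y; rewrite !psumE mulr_sumr; apply: eq_bigr => x _.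
  by rewrite l2_scaleE mulrA.
exact: (@cvgMl_tmp R[i]) (@l2dot_cvg f h).
Qed.

Lemma l2dotC f g : l2dot g f = (l2dot f g)^*.
Proof.
apply: l2dot_unique; apply/(@cvgrPdist_le R[i] R[i]^o) => e e0.
have /(@cvgrPdist_le R[i] R[i]^o)/(_ e e0) := @l2dot_cvg f g.
apply: filterS => Y; rewrite (_ : psum g f Y = (psum f g Y)^*).
  by rewrite -rmorphB /= norm_conjC.
rewrite !psumE rmorph_sum; apply: eq_bigr => x _ /=.
by rewrite rmorphM /= conjCK mulrC.
Qed.

Lemma l2dotDr f g h : l2dot f (g + h) = l2dot f g + l2dot f h.
Proof. by rewrite l2dotC l2dotDl rmorphD /= -!l2dotC. Qed.

Lemma l2dotZr c f g : l2dot f (c *: g) = c^* * l2dot f g.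
Proof. by rewrite l2dotC l2dotZl rmorphM /= -!l2dotC. Qed.

Lemma l2dot0l f : l2dot 0 f = 0.
Proof. by rewrite -(scale0r (0 : l2 R X)) l2dotZl mul0r. Qed.

Lemma l2dot0r f : l2dot f 0 = 0.
Proof. by rewrite l2dotC l2dot0l conjC0. Qed.

Lemma l2dotNl f g : l2dot (- f) g = - l2dot f g.
Proof. by rewrite -scaleN1r l2dotZl mulN1r. Qed.

Lemma l2dotNr f g : l2dot f (- g) = - l2dot f g.
Proof. by rewrite l2dotC l2dotNl rmorphN /= -l2dotC. Qed.

Lemma l2dotBl f g h : l2dot (f - g) h = l2dot f h - l2dot g h.
Proof. by rewrite l2dotDl l2dotNl. Qed.

Lemma l2dotBr f g h : l2dot f (g - h) = l2dot f g - l2dot f h.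
Proof. by rewrite l2dotDr l2dotNr. Qed.

Lemma l2dot_suml (I : Type) (r : seq I) (F : I -> l2 R X) g :
  l2dot (\sum_(i <- r) F i) g = \sum_(i <- r) l2dot (F i) g.
Proof. by elim/big_rec2 : _ => [|i y z _ <-]; rewrite ?l2dot0l ?l2dotDl. Qed.

Lemma l2dot_sumr (I : Type) (r : seq I) (F : I -> l2 R X) g :
  l2dot g (\sum_(i <- r) F i) = \sum_(i <- r) l2dot g (F i).
Proof. by elim/big_rec2 : _ => [|i y z _ <-]; rewrite ?l2dot0r ?l2dotDr. Qed.

Lemma l2dot_self f : l2dot f f = (l2norm f ^+ 2)%:C.
Proof. exact/l2dot_unique/psum_self. Qed.

Lemma l2dot_deltal f (x : X) : l2dot (l2_delta x) f = (f x)^*.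
Proof. by rewrite l2dotC l2dot_delta. Qed.

Lemma l2_deltaE (x y : X) : @l2_delta R X x y = (y == x)%:R.
Proof. by []. Qed.

Lemma l2norm_delta (x : X) : l2norm (@l2_delta R X x) = 1.
Proof.
have : (l2norm (@l2_delta R X x) ^+ 2)%:C = 1.
  by rewrite -l2dot_self l2dot_delta l2_deltaE eqxx.
move/complexI => h; apply/eqP; rewrite -sqrp_eq1 ?l2norm_ge0//; exact/eqP.
Qed.

Lemma l2dot_disjoint f g : (forall x, f x * (g x)^* = 0) -> l2dot f g = 0.
Proof.
move=> fg; apply: l2dot_unique; rewrite (_ : psum f g = fun=> 0).
  exact: cvg_cst.
by apply/funext => Y; rewrite psumE big1.
Qed.

Lemma pythagoras f g : l2dot f g = 0 ->
  l2norm (f + g) ^+ 2 = l2norm f ^+ 2 + l2norm g ^+ 2.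
Proof.
move=> fg; apply: complexI; rewrite -l2dot_self l2dotDl !l2dotDr fg.
by rewrite [l2dot g f]l2dotC fg conjC0 addr0 add0r !l2dot_self -rmorphD.
Qed.

Lemma cauchy_schwarz f g : normc (l2dot f g) <= l2norm f * l2norm g.
Proof.
have [->|g0] := eqVneq g 0; first by rewrite l2dot0r normc0 l2norm0 mulr0.
have ng : 0 < l2norm g.
  by rewrite lt_neqAle l2norm_ge0 andbT eq_sym; apply: contraNneq g0 => /l2norm_eq0 ->.
set d := l2dot f g; set n := l2norm g.
have n2 : (n ^+ 2)%:C != 0 :> R[i].
  by rewrite -(rmorph0 (real_complex R)) (inj_eq (@complexI R)) expf_neq0// gt_eqF.
(* [c *: g] is the orthogonal projection of [f] onto the line of [g]; the inequality says that it is
   no longer than [f]. *)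
pose c := d / (n ^+ 2)%:C.
have h : l2dot (f - c *: g) (c *: g) = 0.
  rewrite l2dotBl l2dotZr l2dotZl l2dotZr -/d l2dot_self -/n /c.
  by rewrite mulrCA divfK// subrr.
have hp : l2norm (c *: g) <= l2norm f.
  rewrite -(@ler_sqr R) ?nnegrE ?l2norm_ge0//.
  by have := pythagoras h; rewrite subrK => ->; rewrite lerDr sqr_ge0.
move: hp; rewrite l2normZ /c normcM normcV normc_real ger0_norm ?sqr_ge0//.
by rewrite -/n expr2 invfM -!mulrA mulVf ?gt_eqF// mulr1 ler_pdivrMr.
Qed.
End InnerProduct.

(** * Bounded operators and adjoints *)

Section BoundedOperators.
Context {R : realType} {X : choiceType}.
Local Notation H := (l2 R X).
Implicit Types (f g h : H) (Y : {fset X}) (c : R[i]) (a b : H -> H).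

(** Any real upper bound [C] may replace the operator norm. This avoids arithmetic with the extended
    real [opnorm], and a common [C] is what ultralimits of operators require. *)
Definition opbd (C : R) a : Prop :=
  [/\ 0 <= C, linear a & forall f, l2norm (a f) <= C * l2norm f].

Section Linear.
Variable a : H -> H.
Hypothesis la : linear a.

Lemma linD f g : a (f + g) = a f + a g.
Proof. by have := la 1 f g; rewrite !scale1r. Qed.
Lemma lin0 : a 0 = 0.
Proof. by have := linD 0 0; rewrite addr0 => /eqP; rewrite -subr_eq subrr => /eqP <-. Qed.
Lemma linZ c f : a (c *: f) = c *: a f.
Proof. by have := la c f 0; rewrite !addr0 lin0 addr0. Qed.
Lemma linN f : a (- f) = - a f.
Proof. by rewrite -scaleN1r linZ scaleN1r. Qed.
Lemma linB f g : a (f - g) = a f - a g.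
Proof. by rewrite linD linN. Qed.
Lemma lin_sum (I : Type) (r : seq I) (F : I -> H) :
  a (\sum_(i <- r) F i) = \sum_(i <- r) a (F i).
Proof. by elim/big_rec2 : _ => [|i y z _ <-]; rewrite ?lin0 ?linD. Qed.
End Linear.

Lemma opnorm_leP a (C : R) : 0 <= C -> linear a ->
  (opnorm a <= C%:E)%E <-> (forall f, l2norm (a f) <= C * l2norm f).
Proof.
move=> C0 la; split => [aC f|aC].
  have [->|f0] := eqVneq f 0; first by rewrite (lin0 la) l2norm0 mulr0.
  have nf : 0 < l2norm f.
    by rewrite lt_neqAle l2norm_ge0 andbT eq_sym; apply: contraNneq f0 => /l2norm_eq0 ->.
  have nc : normc ((l2norm f)^-1%:C : R[i]) = (l2norm f)^-1.
    by rewrite normc_real ger0_norm// invr_ge0 ltW.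
  rewrite -ler_pdivrMr// mulrC -nc -l2normZ -(linZ la) -lee_fin.
  apply: le_trans aC; apply: ereal_sup_ubound.
  exists ((l2norm f)^-1%:C *: f) => //=.
  by rewrite l2normZ nc mulVf// gt_eqF.
apply: ge_ereal_sup => _ /= [f f1 <-]; rewrite lee_fin.
by rewrite (le_trans (aC f))// ler_piMr.
Qed.

Lemma opbd_opnorm a C : opbd C a -> (opnorm a <= C%:E)%E.
Proof. by case=> C0 la aC; apply/opnorm_leP. Qed.

Lemma bounded_opP a : bounded_op a <-> exists C, opbd C a.
Proof.
split=> [[la na]|[C aC]]; last first.
  by case: (aC) => _ la _; split => //; rewrite (le_lt_trans (opbd_opnorm aC))// ltry.
have n0 : (0 <= opnorm a)%E.
  by apply: ereal_sup_ubound; exists 0; rewrite ?(lin0 la) /= ?l2norm0.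
exists (fine (opnorm a)); split => //; first exact: fine_ge0.
apply/opnorm_leP => //; first exact: fine_ge0.
by rewrite fineK// ge0_fin_numE.
Qed.

Lemma opbdD C C' a b : opbd C a -> opbd C' b -> opbd (C + C') (a + b).
Proof.
move=> [C0 la aC] [C0' lb bC']; split; first exact: addr_ge0.
  by move=> c f g; rewrite !fctE la lb scalerDr addrACA.
by move=> f; rewrite mulrDl (le_trans (l2normD _ _))// lerD.
Qed.

Lemma opbdZ C a c : opbd C a -> opbd (normc c * C) (c *: a).
Proof.
move=> [C0 la aC]; split; first by rewrite mulr_ge0 ?normc_nonneg.
  by move=> d f g; rewrite !fctE la scalerDr !scalerA mulrC.
by move=> f; rewrite [(c *: a) f]/(c *: a f) l2normZ -mulrA ler_wpM2l ?normc_nonneg.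
Qed.

Lemma opbdN C a : opbd C a -> opbd C (- a).
Proof. by move=> /(opbdZ (-1)); rewrite scaleN1r normcN normc1 mul1r. Qed.

Lemma opbdB C C' a b : opbd C a -> opbd C' b -> opbd (C + C') (a - b).
Proof. by move=> aC /opbdN bC; exact: opbdD. Qed.

Lemma opbd_comp C C' a b : opbd C a -> opbd C' b -> opbd (C * C') (a \o b).
Proof.
move=> [C0 la aC] [C0' lb bC']; split; first exact: mulr_ge0.
  by move=> c f g; rewrite /= lb la.
by move=> f; rewrite /= (le_trans (aC _))// -mulrA ler_wpM2l.
Qed.

Lemma opbd0 : opbd 0 (0 : H -> H).
Proof.
split=> // [c f g|f]; first by change ((0 : H) = c *: (0 : H) + 0); rewrite scaler0 addr0.
by rewrite mul0r -[X in l2norm X]/(0 : H) l2norm0.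
Qed.

Lemma opbd_sum (I : Type) (r : seq I) (F : I -> H -> H) (C : I -> R) :
  (forall i, opbd (C i) (F i)) -> opbd (\sum_(i <- r) C i) (\sum_(i <- r) F i).
Proof. by move=> FC; elim/big_rec2 : _ => [|i a b _]; [exact: opbd0|exact: opbdD]. Qed.

Lemma l2_chi_fset Y f : l2_chi [set` Y] f = \sum_(x <- Y) f x *: l2_delta x.
Proof.
apply: l2_ext => y; rewrite l2_sumE l2_chiE.
case: ifPn => [/set_mem /= yY|/negP yY].
  rewrite (big_fsetD1 y yY) l2_scaleE l2_deltaE eqxx mulr1 big1_seq; [by rewrite /= addr0|move=> x].
  by move=> /andP[_ /[!inE]/andP[xy _]]; rewrite l2_scaleE l2_deltaE eq_sym (negbTE xy) mulr0.
rewrite big1_seq// => x /andP[_ xY]; rewrite l2_scaleE l2_deltaE.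
by case: eqVneq => [yx|]; rewrite ?mulr0//; case: yY; rewrite mem_set//= yx.
Qed.

(** Finitely supported vectors are dense and [D] is continuous. Equality of operators and the
    adjoint relation are reduced to basis vectors in this way. *)
Lemma functional_delta_eq0 (D : H -> R[i]) (K : R) :
  (forall c f g, D (c *: f + g) = c * D f + D g) ->
  (forall f, normc (D f) <= K * l2norm f) ->
  (forall x, D (l2_delta x) = 0) -> forall f, D f = 0.
Proof.
move=> lD DK D0 f.
have Dz : D 0 = 0 by have := lD 1 0 0; rewrite scaler0 addr0 mul1r => /eqP; rewrite -subr_eq subrr => /eqP <-.
have Dchi Y : D (l2_chi [set` Y] f) = 0.
  rewrite l2_chi_fset; elim/big_rec : _ => // x g _ Dg.
  by rewrite lD D0 mulr0 add0r.
apply: eq0_normc; apply/eqP; rewrite eq_le normc_nonneg andbT.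
apply/ler_addgt0Pl => e e0; rewrite addr0.
have K1 : 0 < `|K| + 1 by rewrite ltr_wpDl.
have [Y HY] := l2_tail f (divr_gt0 e0 K1).
have -> : D f = D (f - l2_chi [set` Y] f).
  by rewrite -{1}[f](subrK (l2_chi [set` Y] f)) -[X in X + _]scale1r lD mul1r Dchi addr0.
rewrite (le_trans (DK _))// (@le_trans _ _ ((`|K| + 1) * (e / (`|K| + 1))))//.
  rewrite (@le_trans _ _ ((`|K| + 1) * l2norm (f - l2_chi [set` Y] f)))//.
    by rewrite ler_wpM2r ?l2norm_ge0// (le_trans (ler_norm K))// lerDl.
  by rewrite ler_wpM2l ?HY// ltW.
by rewrite mulrC divfK// gt_eqF.
Qed.

Lemma opbd_ext C C' a b : opbd C a -> opbd C' b ->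
  (forall x, a (l2_delta x) = b (l2_delta x)) -> a = b.
Proof.
move=> aC bC ab; apply/funext => f; apply: l2_ext => x.
apply/eqP; rewrite -subr_eq0; apply/eqP.
have [_ lab abC] := opbdB aC bC.
apply: (@functional_delta_eq0 (fun f => (a - b) f x) (C + C')) => [c g h|g|y].
- by rewrite lab.
- exact: le_trans (normc_le_l2norm _ _) (abC _).
- by rewrite l2_subE ab subrr.
Qed.

Definition adjop a g : H := to_l2 (fun x => l2dot g (a (l2_delta x))).

Lemma adjop_bound C a g Y : opbd C a ->
  \sum_(x <- Y) normc (l2dot g (a (l2_delta x))) ^+ 2 <= (C * l2norm g) ^+ 2.
Proof.
move=> [C0 la aC]; set S := \sum_(x <- Y) _.
(* [v] is the candidate adjoint vector cut down to [Y]. Both [l2dot g (a v)] and [l2norm v ^+ 2]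
   equal [S], so Cauchy-Schwarz gives [S <= l2norm g * (C * l2norm v)], and one factor [l2norm v]
   cancels. *)
pose v := l2_chi [set` Y] (to_l2 (fun x => if x \in Y then l2dot g (a (l2_delta x)) else 0)).
have S0 : 0 <= S by apply: sumr_ge0 => x _; exact: sqr_ge0.
have E x : to_l2 (fun x => if x \in Y then l2dot g (a (l2_delta x)) else 0) x =
    if x \in Y then l2dot g (a (l2_delta x)) else 0.
  rewrite (@to_l2E _ _ _ S)// => Z; rewrite (le_trans (sum_fsetD_le _ Y _))// => [y|]; first exact: sqr_ge0.
  rewrite big1_seq ?add0r => [|y /andP[_ /[!inE]/andP[/negbTE -> _]]]; last first.
    by rewrite normc0 expr0n.
  by rewrite le_eqVlt; apply/orP; left; apply/eqP/eq_big_seq => y ->.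
have nv : l2norm v ^+ 2 = S.
  by rewrite l2norm_eq_chi_fset; apply: eq_big_seq => x xY; rewrite E xY.
have gv : l2dot g (a v) = S%:C.
  rewrite /v l2_chi_fset (lin_sum la) l2dot_sumr rmorph_sum; apply: eq_big_seq => x xY.
  by rewrite (linZ la) l2dotZr E xY mulrC; exact: mul_conj_normc.
have : S <= l2norm g * (C * l2norm v).
  rewrite -[leLHS]ger0_norm// -normc_real -gv (le_trans (cauchy_schwarz _ _))//.
  by rewrite ler_wpM2l ?l2norm_ge0.
rewrite mulrA [_ * C]mulrC -nv expr2.
have [->|v0] := eqVneq (l2norm v) 0; first by rewrite mulr0 => _; exact: sqr_ge0.
have vp : 0 < l2norm v by rewrite lt_neqAle eq_sym v0 l2norm_ge0.
rewrite ler_pM2r// => h; rewrite -expr2.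
by rewrite ler_sqr ?nnegrE ?l2norm_ge0// mulr_ge0 ?l2norm_ge0.
Qed.

Lemma adjopE C a g x : opbd C a -> adjop a g x = l2dot g (a (l2_delta x)).
Proof. by move=> aC; rewrite (to_l2E (fun Y => adjop_bound g Y aC)). Qed.

Lemma adjop_opbd C a : opbd C a -> opbd C (adjop a).
Proof.
move=> aC; case: (aC) => C0 la _; split => // [c f g|f].
  by apply: l2_ext => x; rewrite l2_addE l2_scaleE !(adjopE _ _ aC) l2dotDl l2dotZl.
apply: l2norm_le_sum => [|Y]; first by rewrite mulr_ge0 ?l2norm_ge0.
by under eq_bigr do rewrite (adjopE _ _ aC); exact: adjop_bound.
Qed.

Lemma adjopP C a f g : opbd C a -> l2dot (a f) g = l2dot f (adjop a g).
Proof.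
move=> aC; apply/eqP; rewrite -subr_eq0; apply/eqP.
case: (aC) => C0 la aC'; have [_ _ adC] := adjop_opbd aC.
apply: (@functional_delta_eq0 (fun f => l2dot (a f) g - l2dot f (adjop a g))
    (C * l2norm g + C * l2norm g)) => [c u v|u|x].
- rewrite la !l2dotDl !l2dotZl; ring.
- rewrite (le_trans (le_normcD _ _))// normcN mulrDl lerD//.
    by rewrite (le_trans (cauchy_schwarz _ _))// mulrAC ler_wpM2r ?l2norm_ge0.
  by rewrite (le_trans (cauchy_schwarz _ _))// mulrC ler_wpM2r ?l2norm_ge0.
- by rewrite l2dot_deltal (adjopE _ _ aC) -l2dotC subrr.
Qed.

Lemma l2dot_inj g h : (forall f, l2dot f g = l2dot f h) -> g = h.
Proof. by move=> gh; apply: l2_ext => x; apply: (inv_inj (@conjCK _)); rewrite -!l2dot_deltal. Qed.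

Lemma adj_unique a b : bounded_op b ->
  (forall f g, l2dot (a f) g = l2dot f (b g)) -> adj a = b.
Proof.
move=> bb ab; rewrite /adj; apply: xget_unique => // b' [_ ab'].
by apply/funext => g; apply: l2dot_inj => f; rewrite -ab -ab'.
Qed.

Lemma adjE C a : opbd C a -> adj a = adjop a.
Proof.
move=> aC; apply: adj_unique => [|f g]; last exact: adjopP aC.
by apply/bounded_opP; exists C; exact: adjop_opbd.
Qed.

Lemma adjP C a f g : opbd C a -> l2dot (a f) g = l2dot f (adj a g).
Proof. by move=> aC; rewrite (adjE aC); exact: adjopP aC. Qed.

Lemma adj_opbd C a : opbd C a -> opbd C (adj a).
Proof. by move=> aC; rewrite (adjE aC); exact: adjop_opbd. Qed.

End BoundedOperators.

(** * Ultrafilter limits *)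

Section UltraLimit.
Context {R : realType}.

Lemma ultrafilter_pushforward (S T : Type) (U : set_system S) (u : S -> T) :
  UltraFilter U -> UltraFilter (u @ U).
Proof.
move=> UU; split; first exact: fmap_proper_filter.
move=> G PG UG; apply/seteqP; split=> // A GA.
have [//|UA] := @in_ultra_setVsetC _ U (u @^-1` A) UU.
have GC : G (~` A) by apply: UG.
by have := filter_ex (filterI GA GC) => -[x []].
Qed.

(** One ultrafilter finer than [\oo], fixed for the whole proof: every bounded sequence converges
    along it, and to its ordinary limit if there is one. *)
Definition ultra : set_system nat := xget \oo [set U | UltraFilter U /\ \oo `<=` U].

Lemma ultraP : UltraFilter ultra /\ \oo `<=` ultra.
Proof.
rewrite /ultra; case: xgetP => [_ -> //|].
by have [U HU] := ultraFilterLemma eventually_filter; move=> /(_ U).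
Qed.

#[local] Instance ultra_ultra : UltraFilter ultra. Proof. by case: ultraP. Qed.
#[local] Instance ultra_properfilter : ProperFilter ultra. Proof. exact: ultra_proper. Qed.

Lemma ultra_cvg (u : nat -> R) (k : R) : (forall n, `|u n| <= k) ->
  u @ ultra --> lim (u @ ultra).
Proof.
move=> uk.
have := @segment_compact R (- k) k; rewrite compact_ultra => /(_ (u @ ultra)).
case=> [||l [_ ul]].
- exact: ultrafilter_pushforward.
- apply: (@filterE _ ultra) => n; change (u n \in `[- k, k]); rewrite in_itv/=.
  by rewrite -ler_norml.
- by apply/cvg_ex; exists l.
Qed.

Definition ulim (z : nat -> R[i]) : R[i] :=
  Complex (lim (complex.Re (z n) @[n --> ultra])) (lim (complex.Im (z n) @[n --> ultra])).

Definition cbounded (z : nat -> R[i]) := exists k, forall n, normc (z n) <= k.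

Lemma ulim_Re z : cbounded z -> (complex.Re (z n) @[n --> ultra]) --> complex.Re (ulim z).
Proof. by case=> k zk; apply: (@ultra_cvg _ k) => n; exact: le_trans (Re_le_normc _) (zk n). Qed.

Lemma ulim_Im z : cbounded z -> (complex.Im (z n) @[n --> ultra]) --> complex.Im (ulim z).
Proof. by case=> k zk; apply: (@ultra_cvg _ k) => n; exact: le_trans (Im_le_normc _) (zk n). Qed.

Lemma ulim_unique z (l : R[i]) :
  (complex.Re (z n) @[n --> ultra]) --> complex.Re l ->
  (complex.Im (z n) @[n --> ultra]) --> complex.Im l -> ulim z = l.
Proof.
move=> zr zi; rewrite /ulim; apply/eqP; rewrite eq_complex /=; apply/andP.
by split; apply/eqP; apply: cvg_lim.
Qed.

Lemma Re_mulD (c z w : R[i]) : complex.Re (c * z + w) =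
  complex.Re c * complex.Re z - complex.Im c * complex.Im z + complex.Re w.
Proof. by case: c => ? ?; case: z => ? ?; case: w. Qed.

Lemma Im_mulD (c z w : R[i]) : complex.Im (c * z + w) =
  complex.Re c * complex.Im z + complex.Im c * complex.Re z + complex.Im w.
Proof. by case: c => ? ?; case: z => ? ?; case: w. Qed.

Lemma ulimZD (c : R[i]) z w : cbounded z -> cbounded w ->
  ulim (fun n => c * z n + w n) = c * ulim z + ulim w.
Proof.
move=> bz bw; have zr := ulim_Re bz; have zi := ulim_Im bz.
have wr := ulim_Re bw; have wi := ulim_Im bw.
apply: ulim_unique.
  rewrite Re_mulD; under eq_fun do rewrite Re_mulD.
  by apply: cvgD => //; apply: cvgB; apply: cvgMl_tmp.
rewrite Im_mulD; under eq_fun do rewrite Im_mulD.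
by apply: cvgD => //; apply: cvgD; apply: cvgMl_tmp.
Qed.

Lemma ulim_sqr z : cbounded z ->
  (normc (z n) ^+ 2 @[n --> ultra]) --> normc (ulim z) ^+ 2.
Proof.
move=> bz; rewrite sqr_normcE; under eq_fun do rewrite sqr_normcE.
have zr := ulim_Re bz; have zi := ulim_Im bz.
by rewrite !expr2; under eq_fun do rewrite !expr2; apply: cvgD; apply: cvgM.
Qed.

Lemma ulim_cvg z (l : R[i]) :
  (forall e : R, 0 < e -> exists m, forall n, (m <= n)%N -> normc (z n - l) <= e) ->
  ulim z = l.
Proof.
move=> zl; apply: ulim_unique; apply/cvgrPdist_le => e e0; apply: ultraP.2;
  have [m Hm] := zl _ e0; exists m => // n /= mn; rewrite distrC;
  apply: le_trans (Hm n mn).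
  by rewrite (le_trans _ (Re_le_normc _))//; case: (z n) => ? ?; case: (l).
by rewrite (le_trans _ (Im_le_normc _))//; case: (z n) => ? ?; case: (l).
Qed.

Context {X : choiceType}.
Local Notation H := (l2 R X).

Definition ulimv (v : nat -> H) : H := to_l2 (fun x => ulim (fun n => v n x)).

(** The bound [k] makes every coordinate limit exist; the bound [k'], valid from [m] on, survives in
    the limit because only finitely many coordinates are summed. Keeping the two apart lets the tail
    of a sequence control the norm of its limit. *)
Lemma ulimv_sum_le (v : nat -> H) (k k' : R) (m : nat) (Y : {fset X}) :
  (forall n, l2norm (v n) <= k) -> (forall n, (m <= n)%N -> l2norm (v n) <= k') ->
  \sum_(x <- Y) normc (ulim (fun n => v n x)) ^+ 2 <= k' ^+ 2.
Proof.
move=> vk vk'.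
have H : (\sum_(x <- Y) normc (v n x) ^+ 2) @[n --> ultra] -->
    \sum_(x <- Y) normc (ulim (fun n => v n x)) ^+ 2.
  apply: (@cvg_sum_seq R R^o) => x; apply: ulim_sqr; exists k => n.
  exact: le_trans (normc_le_l2norm _ _) (vk n).
apply: (cvgr_to_le H); apply: ultraP.2; exists m => // n /= mn.
rewrite (le_trans (sum_sqr_le _ _))// ler_sqr ?nnegrE ?vk' ?l2norm_ge0//.
exact: le_trans (l2norm_ge0 _) (vk' n mn).
Qed.

Lemma ulimvE (v : nat -> H) (k : R) x : (forall n, l2norm (v n) <= k) ->
  ulimv v x = ulim (fun n => v n x).
Proof. by move=> vk; rewrite (to_l2E (fun Y => ulimv_sum_le (m := 0%N) Y vk (fun n _ => vk n))). Qed.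

Lemma ulimv_le (v : nat -> H) (k k' : R) (m : nat) :
  (forall n, l2norm (v n) <= k) -> (forall n, (m <= n)%N -> l2norm (v n) <= k') ->
  l2norm (ulimv v) <= k'.
Proof.
move=> vk vk'; apply: l2norm_le_sum => [|Y].
  exact: le_trans (l2norm_ge0 _) (vk' m (leqnn m)).
by under eq_bigr do rewrite (ulimvE _ vk); exact: ulimv_sum_le vk vk'.
Qed.

Lemma cbounded_l2 (v : nat -> H) (k : R) x : (forall n, l2norm (v n) <= k) ->
  cbounded (fun n => v n x).
Proof. by move=> vk; exists k => n; exact: le_trans (normc_le_l2norm _ _) (vk n). Qed.

Lemma ulimvZD (c : R[i]) (v w : nat -> H) (k k' : R) :
  (forall n, l2norm (v n) <= k) -> (forall n, l2norm (w n) <= k') ->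
  ulimv (fun n => c *: v n + w n) = c *: ulimv v + ulimv w.
Proof.
move=> vk wk; apply: l2_ext => x.
rewrite l2_addE l2_scaleE (ulimvE _ vk) (ulimvE _ wk).
rewrite (@ulimvE _ (normc c * k + k')).
  by rewrite -ulimZD//; [exact: cbounded_l2 vk|exact: cbounded_l2 wk].
move=> n; rewrite (le_trans (l2normD _ _))// lerD// l2normZ.
by rewrite ler_wpM2l ?normc_nonneg.
Qed.

(* Ultrafilter limits of operators play the role of weak operator compactness. *)
Definition ulimop (a : nat -> H -> H) (f : H) : H := ulimv (fun n => a n f).

Lemma ulimop_opbd (a : nat -> H -> H) (C : R) : (forall n, opbd C (a n)) -> opbd C (ulimop a).
Proof.
move=> aC; have C0 : 0 <= C by case: (aC 0%N).
have aC' f n : l2norm (a n f) <= C * l2norm f by case: (aC n).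
split => // [c f g|f]; last exact: (@ulimv_le _ _ _ 0%N (aC' f)).
rewrite /ulimop -(ulimvZD _ (aC' f) (aC' g)); congr ulimv; apply/funext => n.
by have [_ -> _] := aC n.
Qed.

Lemma ulimop_sub_le (a b : nat -> H -> H) (C C' e : R) f :
  (forall n, opbd C (a n)) -> (forall n, opbd C' (b n)) ->
  (forall n, l2norm (a n f - b n f) <= e) -> l2norm (ulimop a f - ulimop b f) <= e.
Proof.
move=> aC bC abe.
have aC' n : l2norm (a n f) <= C * l2norm f by case: (aC n).
have bC' n : l2norm (b n f) <= C' * l2norm f by case: (bC n).
have -> : ulimop a f - ulimop b f = ulimv (fun n => a n f - b n f).
  rewrite addrC -scaleN1r -(ulimvZD _ bC' aC'); congr ulimv; apply/funext => n.
  by rewrite scaleN1r addrC.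
exact: (@ulimv_le _ _ _ 0%N abe).
Qed.
End UltraLimit.

(** * Orthonormal sequences *)

Section OrthonormalBases.
Context {R : realType} {X : choiceType}.
Local Notation H := (l2 R X).
Implicit Types (v w : H) (s : seq nat).

Lemma l2norm_small0 v : (forall e : R, 0 < e -> l2norm v <= e) -> v = 0.
Proof.
move=> H; apply: l2norm_eq0; apply/eqP; rewrite eq_le l2norm_ge0 andbT.
by apply/ler_addgt0Pl => e e0; rewrite addr0 H.
Qed.

Lemma normc_small0 (z : R[i]) : (forall e : R, 0 < e -> normc z <= e) -> z = 0.
Proof.
move=> H; apply: eq0_normc; apply/eqP; rewrite eq_le normc_nonneg andbT.
by apply/ler_addgt0Pl => e e0; rewrite addr0 H.
Qed.

Lemma ulimv_cst v : ulimv (fun=> v) = v.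
Proof.
apply: l2_ext => x; rewrite (@ulimvE _ _ _ (l2norm v))//.
by apply: ulim_cvg => e e0; exists 0%N => n _; rewrite subrr normc0 ltW.
Qed.

(** The coordinatewise ultralimit serves as the limit of the Cauchy sequence: from [L] on, the
    vectors [v n - v L] have norm at most [e / 2], hence so does their ultralimit
    [ulimv v - v L]. *)
Lemma l2_complete (v : nat -> H) (k : R) : (forall n, l2norm (v n) <= k) ->
  (forall e : R, 0 < e -> exists L, forall M, (L <= M)%N -> l2norm (v M - v L) <= e) ->
  forall e : R, 0 < e -> exists L, forall M, (L <= M)%N -> l2norm (ulimv v - v M) <= e.
Proof.
move=> vk vC e e0; have e2 : 0 < e / 2 by rewrite divr_gt0.
have [L HL] := vC _ e2; exists L => M LM.
have -> : ulimv v - v M = (ulimv v - v L) - (v M - v L) by rewrite opprB addrA subrK.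
apply: (le_trans (l2normB _ _)); rewrite [X in _ <= X](splitr e).
apply: lerD; last exact: HL.
have -> : ulimv v - v L = ulimv (fun n => v n - v L).
  rewrite -[in LHS](ulimv_cst (v L)) addrC -scaleN1r.
  rewrite -(@ulimvZD _ _ (-1) (fun=> v L) v k k (fun=> vk L) vk); congr ulimv; apply/funext => n.
  by rewrite scaleN1r addrC.
apply: (@ulimv_le _ _ _ (k + k) _ L) => // n.
by rewrite (le_trans (l2normB _ _))// lerD.
Qed.

Variable xi : nat -> H.
Hypothesis xi_on : forall m n, l2dot (xi m) (xi n) = (m == n)%:R.

Let coef v n := l2dot v (xi n).

Lemma l2dot_xi_sum s (c : nat -> R[i]) n : uniq s ->
  l2dot (\sum_(m <- s) c m *: xi m) (xi n) = if n \in s then c n else 0.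
Proof.
move=> us; rewrite l2dot_suml; under eq_bigr do rewrite l2dotZl xi_on.
case: ifPn => ns.
  rewrite (bigD1_seq n)//= eqxx mulr1 big1 ?addr0// => m /negbTE ->.
  by rewrite mulr0.
rewrite big1_seq// => m /andP[_ ms]; case: eqVneq => [mn|]; last by rewrite mulr0.
by rewrite -mn ms in ns.
Qed.

Lemma l2norm_xi_sum s (c : nat -> R[i]) : uniq s ->
  l2norm (\sum_(m <- s) c m *: xi m) ^+ 2 = \sum_(m <- s) normc (c m) ^+ 2.
Proof.
move=> us; apply: complexI; rewrite -l2dot_self l2dot_sumr rmorph_sum.
apply: eq_big_seq => m ms; rewrite l2dotZr l2dot_xi_sum// ms mulrC.
exact: mul_conj_normc.
Qed.

Lemma l2norm_sub_xi_sum s v : uniq s ->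
  l2norm (v - \sum_(m <- s) coef v m *: xi m) ^+ 2 =
  l2norm v ^+ 2 - \sum_(m <- s) normc (coef v m) ^+ 2.
Proof.
move=> us; set P := \sum_(m <- s) _.
have vP : l2dot (v - P) P = 0.
  rewrite {2}/P l2dot_sumr big1_seq// => m /andP[_ ms].
  by rewrite l2dotZr l2dotBl l2dot_xi_sum// ms subrr mulr0.
have := pythagoras vP; rewrite subrK => ->.
by rewrite [l2norm P ^+ 2]l2norm_xi_sum// addrK.
Qed.

Lemma bessel s v : uniq s -> \sum_(m <- s) normc (coef v m) ^+ 2 <= l2norm v ^+ 2.
Proof. by move=> us; rewrite -subr_ge0 -l2norm_sub_xi_sum// sqr_ge0. Qed.

Lemma l2norm_xi n : l2norm (xi n) = 1.
Proof.
have : (l2norm (xi n) ^+ 2)%:C = 1 by rewrite -l2dot_self xi_on eqxx.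
by move/complexI => h; apply/eqP; rewrite -sqrp_eq1 ?l2norm_ge0//; exact/eqP.
Qed.

Definition xi_partial (M : nat) v : H := \sum_(m <- iota 0 M) coef v m *: xi m.

(** The orthogonal projection onto the closed span of [xi]. As an ultralimit of partial sums it
    inherits every bound uniform in [M]; [onproj_cvg] upgrades the convergence to the norm. *)
Definition onproj : H -> H := locked (ulimop xi_partial).

Lemma l2norm_xi_partial M v : l2norm (xi_partial M v) <= l2norm v.
Proof.
rewrite -(@ler_sqr R) ?nnegrE ?l2norm_ge0//.
by rewrite /xi_partial l2norm_xi_sum ?iota_uniq// bessel// iota_uniq.
Qed.

Lemma xi_partial_opbd M : opbd 1 (xi_partial M).
Proof.
split=> // [c f g|f]; last by rewrite mul1r l2norm_xi_partial.
rewrite /xi_partial scaler_sumr -big_split; apply: eq_bigr => m _ /=.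
by rewrite /coef l2dotDl l2dotZl scalerDl scalerA.
Qed.

Lemma onproj_opbd : opbd 1 onproj.
Proof. by rewrite /onproj -lock; exact: ulimop_opbd xi_partial_opbd. Qed.

Lemma onproj_cvg v (e : R) : 0 < e -> exists L, forall M, (L <= M)%N ->
  l2norm (onproj v - xi_partial M v) <= e.
Proof.
rewrite /onproj -lock.
apply: (@l2_complete (xi_partial ^~ v) (l2norm v)); first by move=> M; exact: l2norm_xi_partial.
pose A M := \sum_(m <- iota 0 M) normc (coef v m) ^+ 2.
have Av M : A M <= l2norm v ^+ 2 by apply: bessel; exact: iota_uniq.
have SS L M : (L <= M)%N -> l2norm (xi_partial M v - xi_partial L v) ^+ 2 = A M - A L.
  move=> /subnKC <-; rewrite /xi_partial /A iotaD !big_cat /=.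
  rewrite [X in X - _]addrC addrK [X in _ = X - _]addrC addrK add0n.
  by rewrite l2norm_xi_sum ?iota_uniq.
move=> d d0; have hs : has_sup (range A).
  by split; [exists (A 0%N), 0%N|exists (l2norm v ^+ 2) => _ [n _ <-]].
have [_ [L _ <-] HL] := sup_adherent (exprn_gt0 2 d0) hs.
exists L => M LM; rewrite -(@ler_sqr R) ?nnegrE ?l2norm_ge0 ?ltW// SS//.
have : A M <= sup (range A) by apply: sup_upper_bound => //; exists M.
lra.
Qed.

Lemma onproj_dot v w (e : R) : 0 < e -> exists L, forall M, (L <= M)%N ->
  normc (l2dot (onproj v) w - l2dot (xi_partial M v) w) <= e.
Proof.
move=> e0; have K0 : 0 < l2norm w + 1 by rewrite ltr_wpDl ?l2norm_ge0.
have [L HL] := onproj_cvg v (divr_gt0 e0 K0); exists L => M /HL h.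
rewrite -l2dotBl (le_trans (cauchy_schwarz _ _))//.
rewrite (le_trans (ler_wpM2r (l2norm_ge0 _) h))// mulrAC ler_pdivrMr//.
by rewrite ler_pM2l// lerDl.
Qed.

Lemma onproj_coef v n : coef (onproj v) n = coef v n.
Proof.
apply/eqP; rewrite -subr_eq0; apply/eqP; apply: normc_small0 => d d0.
have [L HL] := onproj_dot v (xi n) d0.
rewrite (le_trans _ (HL (L + n.+1)%N (leq_addr _ _)))//.
rewrite /xi_partial l2dot_xi_sum ?iota_uniq// mem_iota add0n ifT//.
by rewrite leq0n/= addnS ltnS leq_addl.
Qed.

Lemma onproj_orth v w : (forall n, l2dot (xi n) w = 0) -> l2dot (onproj v) w = 0.
Proof.
move=> w0; apply: normc_small0 => d d0; have [L /(_ L (leqnn L)) HL] := onproj_dot v w d0.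
rewrite (le_trans _ HL)// [l2dot (xi_partial _ _) _](_ : _ = 0) ?subr0//.
by rewrite /xi_partial l2dot_suml big1_seq// => m _; rewrite l2dotZl w0 mulr0.
Qed.

Lemma onproj_ext v w : (forall n, coef v n = coef w n) -> onproj v = onproj w.
Proof.
move=> vw; rewrite /onproj -lock; congr ulimv; apply/funext => M; apply: eq_bigr => m _.
by rewrite vw.
Qed.


Lemma onproj_idem v : onproj (onproj v) = onproj v.
Proof. by apply: onproj_ext => n; exact: onproj_coef. Qed.

Lemma onproj_sym v w : l2dot (onproj v) w = l2dot v (onproj w).
Proof.
suff h f g : l2dot (onproj f) g = l2dot (onproj f) (onproj g).
  move: (h v w) (h w v); move: (onproj v) (onproj w) => a b h1 h2.
  by rewrite h1 (l2dotC b v) h2 -l2dotC.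
apply/eqP; rewrite eq_sym -subr_eq0 -l2dotBr; apply/eqP/onproj_orth => n.
rewrite l2dotBr (l2dotC _ (xi n)) (l2dotC g (xi n)).
by have := onproj_coef g n; rewrite /coef => ->; rewrite subrr.
Qed.

Lemma onproj_fix n : onproj (xi n) = xi n.
Proof.
apply/eqP; rewrite -subr_eq0; apply/eqP; apply: l2norm_eq0; apply/eqP.
rewrite -sqrf_eq0; apply/eqP/complexI; rewrite -l2dot_self.
have h m : coef (onproj (xi n) - xi n) m = 0.
  by rewrite /coef l2dotBl; have := onproj_coef (xi n) m; rewrite /coef => ->; rewrite subrr.
have h' m : l2dot (xi m) (onproj (xi n) - xi n) = 0.
  by rewrite l2dotC; have := h m; rewrite /coef => ->; rewrite conjC0.
by rewrite l2dotBl onproj_orth// h' subrr.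
Qed.

Hypothesis xi_total : forall v, (forall n, coef v n = 0) -> v = 0.

Lemma xi_coef_inj v w : (forall n, coef v n = coef w n) -> v = w.
Proof.
move=> vw; apply/eqP; rewrite -subr_eq0; apply/eqP; apply: xi_total => n.
by apply/eqP; rewrite /coef l2dotBl subr_eq0; apply/eqP/vw.
Qed.

Lemma xi_expansion v (e : R) : 0 < e -> exists L, forall M, (L <= M)%N ->
  l2norm (v - \sum_(m <- iota 0 M) coef v m *: xi m) <= e.
Proof.
have {1}-> : v = onproj v by apply: xi_coef_inj => n; rewrite onproj_coef.
exact: onproj_cvg.
Qed.

Lemma le_xi_coef v w (C : R) : 0 <= C ->
  (forall n, normc (coef w n) <= C * normc (coef v n)) -> l2norm w <= C * l2norm v.
Proof.
move=> C0 wv; apply/ler_addgt0Pl => e e0.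
have [L /(_ L (leqnn L)) HL] := xi_expansion w e0.
set S := \sum_(m <- _) _ in HL.
rewrite -[w](subrK S) (le_trans (l2normD _ _))// lerD//.
rewrite -(@ler_sqr R) ?nnegrE ?mulr_ge0 ?l2norm_ge0//.
rewrite /S l2norm_xi_sum ?iota_uniq// exprMn.
rewrite (@le_trans _ _ (C ^+ 2 * \sum_(m <- iota 0 L) normc (coef v m) ^+ 2))//; last first.
  by rewrite ler_wpM2l ?sqr_ge0// bessel// iota_uniq.
rewrite mulr_sumr; apply: ler_sum => n _; rewrite -exprMn.
by rewrite ler_sqr ?nnegrE ?mulr_ge0 ?normc_nonneg.
Qed.
End OrthonormalBases.

Lemma onproj_sub_le (R : realType) (X : choiceType) (xi eta : nat -> l2 R X)
    (f : l2 R X) (e : R) :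
  (forall m n, l2dot (xi m) (xi n) = (m == n)%:R) ->
  (forall m n, l2dot (eta m) (eta n) = (m == n)%:R) ->
  (forall M, l2norm (xi_partial xi M f - xi_partial eta M f) <= e) ->
  l2norm (onproj xi f - onproj eta f) <= e.
Proof.
move=> xi_on eta_on H; rewrite /onproj -!lock.
by apply: ulimop_sub_le H => M; exact: xi_partial_opbd.
Qed.

(** * Operator algebras and finite propagation *)

Section CstarClosure.
Context {R : realType} {X : choiceType}.
Local Notation H := (l2 R X).
Implicit Types (a b : H -> H) (A D : set (H -> H)).

Lemma norm_closureP D a : D `<=` bounded_op ->
  norm_closure D a <-> bounded_op a /\ (forall e : R, 0 < e ->
    exists2 b, D b & forall f, l2norm (a f - b f) <= e * l2norm f).
Proof.
move=> Db; split=> -[ba aD]; split => // e e0.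
  have [b bD ab] := aD e e0; exists b => //.
  have [C aC] := (bounded_opP a).1 ba; have [C' bC] := (bounded_opP b).1 (Db _ bD).
  have [_ lab _] := opbdB aC bC.
  by apply: (opnorm_leP (ltW e0) lab).1; exact: ltW.
have [b bD ab] := aD (e / 2) ltac:(lra); exists b => //.
have [C aC] := (bounded_opP a).1 ba; have [C' bC] := (bounded_opP b).1 (Db _ bD).
have [_ lab _] := opbdB aC bC.
rewrite (@le_lt_trans _ _ (e / 2)%:E)//.
  by apply: (opnorm_leP _ lab).2 => //; rewrite divr_ge0 ?ltW.
by rewrite lte_fin; lra.
Qed.

Lemma bounded_op_cstar : cstar_subalgebra (@bounded_op R X).
Proof.
split; last by move=> a [].
split => //.
- by apply/bounded_opP; exists 0; exact: opbd0.
- move=> c a b /bounded_opP[C aC] /bounded_opP[C' bC]; apply/bounded_opP.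
  by exists (normc c * C + C'); apply: opbdD => //; exact: opbdZ.
- move=> a b /bounded_opP[C aC] /bounded_opP[C' bC]; apply/bounded_opP.
  by exists (C * C'); exact: opbd_comp.
- move=> a /bounded_opP[C aC]; apply/bounded_opP; exists C; exact: adj_opbd.
Qed.

Lemma norm_closure_mono A D : A `<=` D -> norm_closure A `<=` norm_closure D.
Proof. by move=> AD a [ba aA]; split => // e /aA[b /AD Db ab]; exists b. Qed.

Lemma cstar_gen_cstar D : D `<=` bounded_op -> cstar_subalgebra (cstar_gen D).
Proof.
move=> Db; split.
  split.
  - by move=> a /(_ bounded_op); apply; split => //; exact: bounded_op_cstar.
  - by move=> M [[[]]].
  - by move=> c a b ga gb M MD; have [[[_ _ H _ _] _] _] := MD; apply: H; [exact: ga|exact: gb].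
  - by move=> a b ga gb M MD; have [[[_ _ _ H _] _] _] := MD; apply: H; [exact: ga|exact: gb].
  - by move=> a ga M MD; have [[[_ _ _ _ H] _] _] := MD; apply: H; exact: ga.
move=> a ga M MD; have [[_ H] _] := MD; apply: H; apply: norm_closure_mono ga.
by move=> b /(_ M); apply.
Qed.

Section Closure.
Variable D : set (H -> H).
Hypothesis hD : cstar_subalgebra D.

Lemma cstar_bd a : D a -> exists C, opbd C a.
Proof. by move=> Da; apply/bounded_opP; case: hD => -[H _ _ _ _] _; exact: H. Qed.
Lemma cstar0 : D 0. Proof. by case: hD => -[]. Qed.
Lemma cstarD a b : D a -> D b -> D (a + b).
Proof. by case: hD => -[_ _ H _ _] _ Da Db; have := H 1 a b Da Db; rewrite scale1r. Qed.
Lemma cstarZ c a : D a -> D (c *: a).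
Proof. by case: hD => -[_ D0 H _ _] _ Da; have := H c a 0 Da D0; rewrite addr0. Qed.
Lemma cstarM a b : D a -> D b -> D (a \o b).
Proof. by case: hD => -[_ _ _ H _] _; exact: H. Qed.
Lemma cstar_adj a : D a -> D (adj a).
Proof. by case: hD => -[_ _ _ _ H] _; exact: H. Qed.
Lemma cstar_sum (I : Type) (r : seq I) (F : I -> H -> H) :
  (forall i, D (F i)) -> D (\sum_(i <- r) F i).
Proof. by move=> DF; elim/big_rec : _ => [|i a _]; [exact: cstar0|exact: cstarD]. Qed.
Lemma cstar_limit C a : opbd C a ->
  (forall e : R, 0 < e -> exists2 b, D b & forall f, l2norm (a f - b f) <= e * l2norm f) -> D a.
Proof.
move=> aC Da; case: hD => -[Db _ _ _ _]; apply; apply/norm_closureP => //.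
by split => //; apply/bounded_opP; exists C.
Qed.
End Closure.
End CstarClosure.

Section RankOneAndMultiplication.
Context {R : realType} {X : choiceType}.
Local Notation H := (l2 R X).
Implicit Types (v w : H) (g : X -> R[i]).

Definition rank1 (w v : H) : H -> H := fun f => l2dot f v *: w.

Lemma rank1_opbd w v : opbd (l2norm v * l2norm w) (rank1 w v).
Proof.
split; first by rewrite mulr_ge0 ?l2norm_ge0.
  by move=> c f g; rewrite /rank1 l2dotDl l2dotZl scalerDl scalerA.
move=> f; rewrite /rank1 l2normZ mulrAC ler_wpM2r ?l2norm_ge0//.
by rewrite mulrC cauchy_schwarz.
Qed.

Lemma adj_rank1 w v : adj (rank1 w v) = rank1 v w.
Proof.
apply: adj_unique; first by apply/bounded_opP; eexists; exact: rank1_opbd.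
by move=> f g; rewrite /rank1 l2dotZl l2dotZr -l2dotC mulrC.
Qed.

Lemma comp_rank1 (a : H -> H) C w v : opbd C a -> a \o rank1 w v = rank1 (a w) v.
Proof. by case=> _ la _; apply/funext => f; rewrite /rank1 /= (linZ la). Qed.

Lemma rank1_comp (a : H -> H) C w v : opbd C a -> rank1 w v \o a = rank1 w (adj a v).
Proof. by move=> aC; apply/funext => f; rewrite /rank1 /= (adjP _ _ aC). Qed.

Definition cbd g (k : R) : Prop := forall x, normc (g x) <= k.

Definition mulop g : H -> H := fun f => to_l2 (fun x => g x * f x).

Lemma mulop_sum_le g (k : R) (f : H) (Y : {fset X}) : cbd g k ->
  \sum_(x <- Y) normc (g x * f x) ^+ 2 <= (k * l2norm f) ^+ 2.
Proof.
move=> gk; rewrite exprMn (le_trans _ (ler_wpM2l (sqr_ge0 k) (sum_sqr_le f Y)))//.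
rewrite mulr_sumr; apply: ler_sum => x _; rewrite normcM exprMn ler_wpM2r ?sqr_ge0//.
have k0 : 0 <= k by exact: le_trans (normc_nonneg _) (gk x).
by rewrite ler_sqr ?nnegrE ?normc_nonneg.
Qed.

Lemma mulopE g k (f : H) x : cbd g k -> mulop g f x = g x * f x.
Proof. by move=> gk; rewrite (to_l2E (fun Y => mulop_sum_le f Y gk)). Qed.

Lemma mulop_opbd g (k : R) : 0 <= k -> cbd g k -> opbd k (mulop g).
Proof.
move=> k0 gk; split => // [c f f'|f].
  by apply: l2_ext => x; rewrite l2_addE l2_scaleE !(mulopE _ _ gk) l2_addE l2_scaleE; ring.
apply: l2norm_le_sum => [|Y]; first by rewrite mulr_ge0 ?l2norm_ge0.
by under eq_bigr do rewrite (mulopE _ _ gk); exact: mulop_sum_le.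
Qed.
End RankOneAndMultiplication.

Section FinitePropagation.
Context {R : realType} {X : metricType R}.
Local Notation H := (l2 R X).
Implicit Types (a b : H -> H) (r : R).

Definition prop_le r a : Prop :=
  forall x z, a (l2_delta z) x != 0 -> mdist z x <= r.

(** Integer bounds are used because the category argument and the countable generating set both
    range over [nat]. *)
Lemma propagationP a : (propagation a < +oo)%E <-> exists n : nat, prop_le n%:R a.
Proof.
split=> [pa|[n na]]; last first.
  rewrite (@le_lt_trans _ _ n%:R%:E) ?ltry//; apply: ge_ereal_sup => _ /= [[z x] /= h <-].
  by rewrite lee_fin; apply: na; rewrite -l2dot_delta.
have [M HM] : exists M : R, (propagation a <= M%:E)%E.
  by move: pa; case: (propagation a) => [M||]// _; [exists M; rewrite lexx|exists 0; rewrite leNye].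
exists (Num.trunc M).+1 => x z h; rewrite (le_trans _ (ltW (truncnS_gt M)))//.
rewrite -lee_fin (le_trans _ HM)//; apply: ereal_sup_ubound; exists (z, x) => //=.
by rewrite l2dot_delta.
Qed.

Lemma prop_leD r a b : prop_le r a -> prop_le r b -> prop_le r (a + b).
Proof.
move=> ra rb x z; rewrite [(a + b) _]/(a _ + b _) l2_addE => h.
have [az|/ra//] := eqVneq (a (l2_delta z) x) 0.
by apply: rb; move: h; rewrite az add0r.
Qed.

Lemma prop_leZ r (c : R[i]) a : prop_le r a -> prop_le r (c *: a).
Proof.
move=> ra x z; rewrite [(c *: a) _]/(c *: a _) l2_scaleE mulf_eq0 negb_or.
by move=> /andP[_ /ra].
Qed.

Lemma prop_le_mulop r g k a : cbd g k -> prop_le r a -> prop_le r (mulop g \o a).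
Proof.
by move=> gk ra x z; rewrite /= (mulopE _ _ gk) mulf_eq0 negb_or => /andP[_ /ra].
Qed.

Lemma roeP a : uniform_roe X a <-> bounded_op a /\
  forall e : R, 0 < e -> exists n C b, [/\ opbd C b, prop_le n%:R b &
    forall f, l2norm (a f - b f) <= e * l2norm f].
Proof.
rewrite /uniform_roe norm_closureP; last by move=> b [].
split=> -[ba aA]; split => // e /aA.
  move=> [b [/bounded_opP[C bC] /propagationP[n nb]] ab].
  by exists n, C, b.
move=> [n [C [b [bC nb ab]]]]; exists b => //; split.
  by apply/bounded_opP; exists C.
by apply/propagationP; exists n.
Qed.

Lemma roe_finprop C n a : opbd C a -> prop_le n%:R a -> uniform_roe X a.
Proof.
move=> aC na; apply/roeP; split; first by apply/bounded_opP; exists C.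
move=> e e0; exists n, C, a; split => // f.
by rewrite subrr l2norm0 mulr_ge0 ?l2norm_ge0// ltW.
Qed.

Lemma roe_mulop g (k : R) : cbd g k -> uniform_roe X (mulop g).
Proof.
move=> gk; have gk' : cbd g `|k| by move=> x; exact: le_trans (gk x) (ler_norm k).
apply: (@roe_finprop `|k| 0%N); first exact: mulop_opbd.
move=> x z; rewrite (mulopE _ _ gk) l2_deltaE.
by have [->|_] := eqVneq x z; rewrite ?mdistxx// mulr0 eqxx.
Qed.

(** Cutting [w] and [v] down to finite sets leaves an operator with finitely many nonzero entries,
    hence of finite propagation. *)
Lemma roe_rank1 (w v : H) : uniform_roe X (rank1 w v).
Proof.
apply/roeP; split; first by apply/bounded_opP; eexists; exact: rank1_opbd.
move=> e e0; have K0 : 0 < l2norm v + l2norm w + 1.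
  by rewrite ltr_wpDl ?addr_ge0 ?l2norm_ge0.
have d0 := divr_gt0 e0 K0; set d := e / _ in d0.
have [Y /(_ Y (fsubset_refl Y)) HY] := l2_tail w d0.
have [Z /(_ Z (fsubset_refl Z)) HZ] := l2_tail v d0.
set w' := l2_chi _ w in HY; set v' := l2_chi _ v in HZ.
have [M HM] : exists M : R, forall x z, x \in Y -> z \in Z -> mdist z x <= M.
  exists (\sum_(x <- Y) \sum_(z <- Z) mdist z x) => x z xY zZ.
  rewrite (big_fsetD1 x xY)/= (big_fsetD1 z zZ)/= -addrA lerDl.
  by rewrite addr_ge0 ?sumr_ge0// => *; rewrite ?sumr_ge0// => *; exact: mdist_ge0.
exists (Num.trunc M).+1, (l2norm v' * l2norm w'), (rank1 w' v'); split.
- exact: rank1_opbd.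
- move=> x z; rewrite /rank1 l2_scaleE l2dot_deltal mulf_eq0 negb_or => /andP[].
  rewrite conjC_eq0 !l2_chiE; case: ifPn => [/set_mem/= zZ _|]; last by rewrite eqxx.
  case: ifPn => [/set_mem/= xY _|]; last by rewrite eqxx.
  by rewrite (le_trans (HM _ _ xY zZ))// ltW// truncnS_gt.
- move=> f; rewrite /rank1.
  have -> : l2dot f v *: w - l2dot f v' *: w' =
      l2dot f v *: (w - w') + l2dot f (v - v') *: w'.
    by rewrite l2dotBr scalerBr scalerBl addrA subrK.
  rewrite (le_trans (l2normD _ _))// !l2normZ.
  have h1 : normc (l2dot f v) * l2norm (w - w') <= (l2norm f * l2norm v) * d.
    by rewrite ler_pM ?normc_nonneg ?l2norm_ge0 ?cauchy_schwarz.
  have h2 : normc (l2dot f (v - v')) * l2norm w' <= (l2norm f * d) * l2norm w.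
    rewrite ler_pM ?normc_nonneg ?l2norm_ge0 ?l2norm_chi//.
    by rewrite (le_trans (cauchy_schwarz _ _))// ler_wpM2l ?l2norm_ge0.
  rewrite (le_trans (lerD h1 h2))// (_ : _ + _ = (l2norm v + l2norm w) * d * l2norm f); last ring.
  rewrite ler_wpM2r ?l2norm_ge0// /d mulrC -mulrA ler_piMr ?ltW//.
  by rewrite mulrC ltr_pdivrMr// mul1r ltrDl.
Qed.
End FinitePropagation.

(** * Operators of finite propagation as finite sums of weighted shifts *)

Section Translations.
Context {R : realType} {X : metricType R}.
Local Notation H := (l2 R X).
Variables (r : R) (N : nat).
Hypothesis ballN : forall x : X, (ball x r #<= `I_N)%card.

Definition ball_fset (x : X) : {fset X} := fset_set (ball x r).

Lemma ball_finite x : finite_set (ball x r : set X).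
Proof. by apply/finite_set_leP; exists N. Qed.

Lemma in_ball_fset x z : (z \in ball_fset x) = (mdist x z < r).
Proof.
rewrite in_fset_set; last exact: ball_finite.
by rewrite ballEmdist; apply/idP/idP => [/set_mem//|h]; rewrite mem_set.
Qed.

Lemma card_sub_ball (Y : {fset X}) x : (forall z, z \in Y -> mdist x z < r) ->
  (#|` Y| <= N)%N.
Proof.
move=> Yb; rewrite -(set_fsetK Y); apply: geq_card_fset_set.
by apply: card_le_trans (ballN x); apply: subset_card_le => z /= /Yb; rewrite ballEmdist.
Qed.

(* The maps [shift k] are not injective, but at most [N]-to-one; this suffices for
   [shiftop k] to be bounded. *)
Definition shift (k : nat) (x : X) : X := nth x (ball_fset x) k.

Lemma shift_near k x : 0 < r -> mdist x (shift k x) < r.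
Proof.
move=> r0; rewrite /shift; case: (ltnP k (size (ball_fset x))) => h.
  by rewrite -in_ball_fset mem_nth.
by rewrite nth_default// mdistxx.
Qed.

Definition shiftop (k : nat) (f : H) : H := to_l2 (fun x => f (shift k x)).

(** All [x] with [shift k x = y] lie in the ball of radius [r] around [y], so [normc (f y) ^+ 2] is
    counted at most [N] times; hence the factor [Num.sqrt N%:R]. *)
Lemma shiftop_sum_le k (f : H) (Y : {fset X}) : 0 < r ->
  \sum_(x <- Y) normc (f (shift k x)) ^+ 2 <= (Num.sqrt N%:R * l2norm f) ^+ 2.
Proof.
move=> r0; rewrite exprMn sqr_sqrtr ?ler0n//.
rewrite (partition_big_imfset _ (shift k))/=.
rewrite (le_trans _ (ler_wpM2l (ler0n _ N) (sum_sqr_le f [fset shift k x | x in Y]%fset)))//.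
rewrite mulr_sumr; apply: ler_sum => y _.
under eq_bigr => x /eqP -> do over.
rewrite big_const_seq iter_addr_0 -[X in X <= _]mulr_natl ler_wpM2r ?sqr_ge0// ler_nat.
rewrite -size_filter.
have -> : size [seq x <- Y | shift k x == y] = #|` [fset x in Y | shift k x == y]|%fset.
  by rewrite -[RHS]sum1_size big_fset/= size_filter -sum1_count.
apply: (@card_sub_ball _ y) => z /[!inE]/andP[_ /eqP <-].
by rewrite metric_sym shift_near.
Qed.

Lemma shiftopE k (f : H) x : 0 < r -> shiftop k f x = f (shift k x).
Proof. by move=> r0; rewrite (to_l2E (fun Y => shiftop_sum_le k f Y r0)). Qed.

Lemma shiftop_opbd k : 0 < r -> opbd (Num.sqrt N%:R) (shiftop k).
Proof.
move=> r0; split; first exact: sqrtr_ge0.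
  by move=> c f g; apply: l2_ext => x; rewrite l2_addE l2_scaleE !shiftopE.
move=> f; apply: l2norm_le_sum => [|Y]; first by rewrite mulr_ge0 ?l2norm_ge0 ?sqrtr_ge0.
by under eq_bigr do rewrite shiftopE//; exact: shiftop_sum_le.
Qed.

Lemma prop_le_shiftop k : 0 < r -> prop_le r (shiftop k).
Proof.
move=> r0 x z; rewrite shiftopE// l2_deltaE.
have [<- _|_] := eqVneq (shift k x) z; last by rewrite eqxx.
by rewrite metric_sym ltW// shift_near.
Qed.

(** Row [x] of [b] vanishes off the ball around [x], and the summand of index [k] carries the entry
    at the point of index [k] of that ball. Balls are open, whence the strict [r' < r]. *)
Lemma finprop_decomposition r' C (b : H -> H) : 0 < r -> r' < r -> opbd C b ->
  prop_le r' b -> exists g : nat -> X -> R[i], (forall k, cbd (g k) C) /\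
    b = \sum_(k < N) (mulop (g k) \o shiftop k).
Proof.
move=> r0 r'r bC r'b.
(* Past the end of the ball [shift k x] defaults to [x]; the value 0 there keeps the diagonal entry
   from being counted again. *)
pose g k x := if (k < size (ball_fset x))%N then b (l2_delta (shift k x)) x else 0.
have C0 : 0 <= C by case: bC.
have gC k : cbd (g k) C.
  move=> x; rewrite /g; case: ifP => _; last by rewrite normc0.
  rewrite (le_trans (normc_le_l2norm _ _))//; have [_ _ h] := bC.
  by rewrite (le_trans (h _))// l2norm_delta mulr1.
exists g; split => //.
have sC : opbd (\sum_(k < N) C * Num.sqrt N%:R) (\sum_(k < N) (mulop (g k) \o shiftop k)).
  by apply: opbd_sum => k; apply: opbd_comp; [exact: mulop_opbd|exact: shiftop_opbd].
apply: (opbd_ext bC sC) => z; apply: l2_ext => x.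
rewrite fct_sumE l2_sumE.
under eq_bigr do rewrite /= (mulopE _ _ (gC _)) shiftopE// l2_deltaE.
have [zx|zx] := boolP (z \in ball_fset x); last first.
  rewrite big1 => [|k _].
    apply/eqP; apply: contraNT zx => /r'b h; rewrite in_ball_fset metric_sym.
    exact: le_lt_trans h r'r.
  rewrite /g; case: ifPn => kx; last by rewrite mul0r.
  have [h|_] := eqVneq (shift k x) z; last by rewrite mulr0.
  by move: zx; rewrite -h /shift mem_nth.
have sN : (size (ball_fset x) <= N)%N.
  by apply: (@card_sub_ball _ x) => w; rewrite in_ball_fset.
have iN : (index z (ball_fset x) < N)%N by rewrite (leq_trans _ sN)// index_mem.
rewrite (bigD1 (Ordinal iN))//= /g index_mem zx /shift nth_index// eqxx mulr1.
rewrite big1 ?addr0// => k kz; case: ifPn => kx; last by rewrite mul0r.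
case: eqVneq => [h|]; last by rewrite mulr0.
by case/eqP: kz; apply: val_inj => /=; rewrite -h index_uniq// fset_uniq.
Qed.
End Translations.

(** * The orthonormal basis diagonalizing the Cartan masa *)

Section DiagonalBasis.
Context {R : realType} {X : metricType R}.
Local Notation H := (l2 R X).
Local Notation A := (uniform_roe X).
Implicit Types (u w : nat -> R[i]) (v f : H).

Lemma linftyP u : linfty u <-> exists k : R, forall n, normc (u n) <= k.
Proof. by split=> -[k uk]; exists k => n; have := uk n; rewrite norm_normc lecR. Qed.

Lemma linfty0 : linfty (0 : nat -> R[i]).
Proof. by apply/linftyP; exists 0 => n; rewrite normc0. Qed.

Lemma linftyM u w : linfty u -> linfty w -> linfty (u * w).
Proof.
move=> /linftyP[k uk] /linftyP[l wl]; apply/linftyP; exists (k * l) => n.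
by rewrite normcM ler_pM ?normc_nonneg.
Qed.

Lemma linftyZD (c : R[i]) u w : linfty u -> linfty w -> linfty (c *: u + w).
Proof.
move=> /linftyP[k uk] /linftyP[l wl]; apply/linftyP; exists (normc c * k + l) => n.
by rewrite (le_trans (le_normcD _ _))// lerD// normcM ler_wpM2l ?normc_nonneg.
Qed.

Lemma linfty_conj u : linfty u -> linfty (fun n => (u n)^*).
Proof. by move=> /linftyP[k uk]; apply/linftyP; exists k => n; rewrite normc_conj. Qed.

Definition point_seq n : nat -> R[i] := fun m => (m == n)%:R.

Lemma linfty_point n : linfty (point_seq n).
Proof.
apply/linftyP; exists 1 => m; rewrite /point_seq.
by case: eqP => _; rewrite ?normc1 ?normc0.
Qed.

Lemma mul_point_seq u n : u * point_seq n = u n *: point_seq n.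
Proof.
apply/funext => m; change (u m * (m == n)%:R = u n * (m == n)%:R).
by have [->//|_] := eqVneq m n; rewrite !mulr0.
Qed.

Lemma adjZD (a b : H -> H) C C' (c : R[i]) : opbd C a -> opbd C' b ->
  adj (c *: a + b) = c^* *: adj a + adj b.
Proof.
move=> aC bC; apply: adj_unique => [|f g].
  apply/bounded_opP; eexists; apply: opbdD (adj_opbd bC); apply: opbdZ.
  exact: adj_opbd aC.
change (l2dot (c *: a f + b f) g = l2dot f (c^* *: adj a g + adj b g)).
by rewrite l2dotDl l2dotDr l2dotZl l2dotZr conjCK (adjP _ _ aC) (adjP _ _ bC).
Qed.

Lemma unit_multiple v : v != 0 -> exists2 c : R[i], c != 0 & l2norm (c *: v) = 1.
Proof.
move=> v0; have nv : l2norm v != 0 by apply: contraNneq v0 => /l2norm_eq0 ->.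
exists ((l2norm v)^-1%:C).
  by rewrite -(rmorph0 (real_complex R)) (inj_eq (@complexI R)) invr_eq0.
by rewrite l2normZ normc_real ger0_norm ?invr_ge0 ?l2norm_ge0// mulVf.
Qed.

Lemma l2dot_unit v : l2norm v = 1 -> l2dot v v = 1.
Proof. by move=> v1; rewrite l2dot_self v1 expr1n. Qed.

Lemma rank1_unit v : l2norm v = 1 -> rank1 v v v = v.
Proof. by move=> v1; rewrite /rank1 l2dot_unit// scale1r. Qed.

Lemma rank1_unit_eq0 v : l2norm v = 1 -> rank1 v v <> 0.
Proof.
move=> v1 /(congr1 (fun a : H -> H => a v)); rewrite /rank1 l2dot_unit// scale1r => v0.
by move: v1; rewrite v0 [X in l2norm X](_ : _ = 0)// l2norm0 => /eqP; rewrite eq_sym oner_eq0.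
Qed.

Variable B : set (H -> H).
Hypotheses (hB : cartan_masa A B) (hL : iso_linfty B).

(** Read off from the Cartan condition that the normalizer generates [A]; this spares a separate
    study of products and adjoints of operators of finite propagation. *)
Lemma roe_cstar : cstar_subalgebra A.
Proof.
case: hB => _ _ -> _; apply: cstar_gen_cstar => a [Aa _].
by case: Aa.
Qed.

Lemma diagonal_basis : exists (xi : nat -> H) (Phi : (nat -> R[i]) -> H -> H),
  [/\ forall m n, l2dot (xi m) (xi n) = (m == n)%:R,
      forall v, (forall n, l2dot v (xi n) = 0) -> v = 0 &
      forall u, linfty u -> B (Phi u) /\
        forall v n, l2dot (Phi u v) (xi n) = u n * l2dot v (xi n)].
Proof.
case: hB => hBc [hBs BA _ hmax] _ [Ups [[UpsB Upslin _] UpsId UpsM Upsfaith]].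
case: hL => Phi [[PhiB Phiinj Phisurj] Philin PhiM Phiadj].
have Phib u : linfty u -> exists C, opbd C (Phi u).
  by move=> lu; apply: (cstar_bd roe_cstar); apply/BA/PhiB.
have Phi0 : Phi 0 = 0.
  have := Philin 1 0 0 linfty0 linfty0; rewrite scaler0 addr0 scale1r => /eqP.
  by rewrite -subr_eq subrr => /eqP <-.
have PhiZ c u : linfty u -> Phi (c *: u) = c *: Phi u.
  by move=> lu; have := Philin c u 0 lu linfty0; rewrite !addr0 Phi0 addr0.
pose p n := Phi (point_seq n).
have lp := linfty_point.
have p0 n : p n <> 0.
  rewrite -Phi0 => /Phiinj; rewrite !inE => /(_ (lp n) linfty0).
  move=> /(congr1 (fun u => u n)); rewrite /point_seq eqxx => /eqP.
  by rewrite oner_eq0.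
have Phip u n : linfty u -> Phi u \o p n = u n *: p n.
  by move=> lu; rewrite /p -PhiM// mul_point_seq PhiZ.
have pPhi u n : linfty u -> p n \o Phi u = u n *: p n.
  by move=> lu; rewrite /p -PhiM// mulrC mul_point_seq PhiZ.
have adjp n : adj (p n) = p n.
  rewrite /p -Phiadj//; congr Phi; apply/funext => m.
  by rewrite /point_seq; case: eqP => _; rewrite ?conjC1 ?conjC0.
have rk n : exists eta : H, l2norm eta = 1 /\ p n = rank1 eta eta.
  have [f pf0] : exists f, p n f != 0.
    apply: contrapT => /forallNP h; apply: (p0 n); apply/funext => f.
    by apply/eqP/negP => /negP/h.
  (* Since [Phi u \o p n = u n *: p n], the unit vector [eta] in the range of [p n] is an
     eigenvector of every [Phi u]; hence the projection [c] onto its line commutes with all of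
     [B]. *)
  have [d d0 nd] := unit_multiple pf0; set eta := d *: p n f in nd.
  have pl : linear (p n) by case: (Phib _ (lp n)) => C [].
  have Phieta u : linfty u -> Phi u eta = u n *: eta.
    move=> lu; have [C [_ lPu _]] := Phib _ lu.
    have := congr1 (fun a : H -> H => a f) (Phip u n lu).
    rewrite /= => h; rewrite /eta (linZ lPu) h scalerA mulrC -scalerA.
    by [].
  pose c := rank1 eta eta.
  have cbd' := rank1_opbd eta eta; rewrite -/c in cbd'.
  have cl : linear c by case: cbd'.
  have cc f' : c (c f') = c f'.
    by rewrite /c /rank1 l2dotZl l2dot_unit// mulr1.
  have cPhi u f' : linfty u -> c (Phi u f') = u n *: c f'.
    move=> lu; have [C PC] := Phib _ lu.
    rewrite /c /rank1 (adjP _ _ PC) -Phiadj// Phieta; last exact: linfty_conj.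
    by rewrite l2dotZr conjCK scalerA.
  have Phic u f' : linfty u -> Phi u (c f') = u n *: c f'.
    move=> lu; have [C [_ lPu _]] := Phib _ lu.
    by rewrite /c /rank1 (linZ lPu) Phieta// !scalerA [u n * _]mulrC.
  (* Maximality of [B] among abelian star-subalgebras puts the rank one projection [c] in [B]. *)
  pose M := [set b | exists u mu, linfty u /\ b = mu *: c + Phi u].
  have compM u w mu nu : linfty u -> linfty w ->
      (mu *: c + Phi u) \o (nu *: c + Phi w) =
      (mu * nu + mu * w n + nu * u n) *: c + Phi (u * w).
    move=> lu lw; apply/funext => f'; have [C [_ lPu _]] := Phib _ lu.
    change (mu *: c (nu *: c f' + Phi w f') + Phi u (nu *: c f' + Phi w f') =
      (mu * nu + mu * w n + nu * u n) *: c f' + Phi (u * w) f').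
    rewrite PhiM// cl lPu cc cPhi// Phic// !scalerDr !scalerA.
    by rewrite addrA -!scalerDl.
  have cA : A c by exact: roe_rank1.
  have MB : M = B.
    apply: hmax.
    - split.
      + move=> _ [u [mu [lu ->]]]; have [C PC] := Phib _ lu; apply/bounded_opP.
        by eexists; apply: opbdD PC; apply: opbdZ cbd'.
      + by exists 0, 0; rewrite Phi0 scale0r addr0; split => //; exact: linfty0.
      + move=> k _ _ [u [mu [lu ->]]] [w [nu [lw ->]]].
        exists (k *: u + w), (k * mu + nu); split; first exact: linftyZD.
        by rewrite Philin// scalerDr scalerA scalerDl addrACA.
      + move=> _ _ [u [mu [lu ->]]] [w [nu [lw ->]]]; rewrite compM//.
        by exists (u * w), (mu * nu + mu * w n + nu * u n); split => //; exact: linftyM.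
      + move=> _ [u [mu [lu ->]]]; have [C PC] := Phib _ lu.
        exists (fun m => (u m)^*), mu^*; split; first exact: linfty_conj.
        by rewrite (adjZD _ cbd' PC) Phiadj// /c adj_rank1.
    - move=> _ [u [mu [lu ->]]]; apply: (cstarD roe_cstar).
        exact: (cstarZ roe_cstar).
      exact/BA/PhiB.
    - move=> _ _ [u [mu [lu ->]]] [w [nu [lw ->]]]; rewrite !compM//.
      by rewrite [w * u]mulrC; congr (_ *: c + _); ring.
    - move=> b /Phisurj[u lu <-]; exists u, 0; rewrite scale0r add0r.
      by split.
  have : B c.
    by rewrite -MB; exists 0, 1; rewrite Phi0 scale1r addr0; split => //; exact: linfty0.
  move=> /Phisurj[t lt tc].
  (* [c] absorbs [p n] on the right, so [c = Phi t] is a multiple of [p n]. Evaluation at [eta] then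
     shows that the factor is 1. *)
  have ct : c = t n *: p n.
    apply/funext => f'; have := cPhi _ f' (lp n); rewrite -/(p n) /point_seq eqxx scale1r => <-.
    by rewrite -tc; have := congr1 (fun a : H -> H => a f') (Phip t n lt).
  exists eta; split => //; rewrite -/c ct.
  have : t n *: eta = 1 *: eta.
    rewrite -Phieta// tc /c /rank1 l2dot_unit//.
  have eta0 : eta != 0 by apply: contraPneq nd => ->; rewrite l2norm0 => /eqP; rewrite eq_sym oner_eq0.
  move=> /eqP; rewrite -subr_eq0 -scalerBl scaler_eq0 (negbTE eta0) orbF subr_eq0 => /eqP ->.
  by rewrite scale1r.
have [xi xiP] := choice rk.
have xi1 n : l2dot (xi n) (xi n) = 1 by apply: l2dot_unit; case: (xiP n).
have pE n : p n = rank1 (xi n) (xi n) by case: (xiP n).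
have coefP u v n : linfty u -> l2dot (Phi u v) (xi n) = u n * l2dot v (xi n).
  move=> lu; have := congr1 (fun a : H -> H => l2dot (a v) (xi n)) (pPhi u n lu).
  by rewrite pE /= [(u n *: _) v]/(u n *: _) /rank1 !l2dotZl xi1 !mulr1.
have Phixi u n : linfty u -> Phi u (xi n) = u n *: xi n.
  move=> lu; have := congr1 (fun a : H -> H => a (xi n)) (Phip u n lu).
  by rewrite pE /= [(u n *: _) _]/(u n *: _) /rank1 xi1 !scale1r.
exists xi, Phi; split.
- move=> m n; case: eqVneq => [->//|mn].
  have := coefP _ (xi m) n (lp n); rewrite Phixi// /point_seq eqxx mul1r (negbTE mn).
  by rewrite scale0r l2dot0l => <-.
(* The expectation of the projection onto [v] is annihilated by every [p n], hence is 0. *)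
- move=> v v0; apply/eqP/negP => /negP vn0.
  have [d d0 nd] := unit_multiple vn0; set w := d *: v in nd.
  have pw n : p n w = 0.
    by rewrite pE /rank1 /w l2dotZl v0 mulr0 scale0r.
  have Aa : A (rank1 w w) by exact: roe_rank1.
  have Ups0 : Ups 0 = 0.
    have A0 := cstar0 roe_cstar.
    have := Upslin 1 0 0 A0 A0; rewrite scaler0 addr0 scale1r => /eqP.
    by rewrite -subr_eq subrr => /eqP <-.
  have [t lt tU] := Phisurj _ (UpsB _ Aa).
  have t0 : t = 0.
    apply/funext => n; have Bp : B (p n) by apply: PhiB; exact: lp.
    have := UpsM _ _ _ Bp Aa Bp.
    have [C pC] := Phib _ (lp n).
    rewrite -[p n \o rank1 w w \o p n]/(p n \o (rank1 w w \o p n)) (rank1_comp _ _ pC) adjp pw.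
    rewrite (_ : p n \o _ = 0); last first.
      by apply/funext => f; rewrite /= /rank1 l2dot0r scale0r pE /rank1 l2dot0l scale0r.
    rewrite Ups0 -tU => h.
    have : 0 = t n *: p n.
      rewrite h -[_ \o _]/(p n \o (Phi t \o p n)) Phip//; apply/funext => f.
      change (p n (t n *: p n f) = t n *: p n f); case: pC => _ pl _.
      rewrite -/(p n) in pl; rewrite (linZ pl); congr (_ *: _).
      have := congr1 (fun a : H -> H => a f) (Phip _ n (lp n)).
      by rewrite /point_seq eqxx scale1r.
    move=> /esym/eqP; rewrite scaler_eq0 => /orP[/eqP//|/eqP pn0].
    by case: (p0 n).
  apply: (rank1_unit_eq0 nd); apply: Upsfaith => //.
  have -> : adj (rank1 w w) \o rank1 w w = rank1 w w.
    by rewrite adj_rank1 (comp_rank1 _ _ (rank1_opbd w w)) (rank1_unit nd).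
  by rewrite -tU t0 Phi0.
- by move=> u lu; split; [exact: PhiB|move=> v n; exact: coefP].
Qed.
End DiagonalBasis.

(** * Ghost projections from flat basis vectors *)

Lemma geometric_sum_le {R : realType} (M : nat) :
  \sum_(k <- iota 0 M) (1 / 2 : R) ^+ k.+1 <= 1.
Proof.
suff -> : \sum_(k <- iota 0 M) (1 / 2 : R) ^+ k.+1 = 1 - (1 / 2) ^+ M.
  by rewrite gerBl exprn_ge0.
elim: M => [|M IH]; first by rewrite big_nil expr0 subrr.
by rewrite -addn1 iotaD big_cat IH /= big_seq1 add0n addn1 exprS; lra.
Qed.

Lemma half_exp_small {R : realType} (e : R) : 0 < e -> exists K, (1 / 2 : R) ^+ K <= e.
Proof.
move=> e0; exists (Num.trunc e^-1).+1; set K := _.+1.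
rewrite mul1r exprVn -[leRHS]invrK lef_pV2 ?posrE ?invr_gt0 ?exprn_gt0//.
rewrite (le_trans (ltW (truncnS_gt _)))// -/K -natrX ler_nat.
exact/ltnW/ltn_expl.
Qed.

Section GhostFree.
Context {R : realType} {X : metricType R}.
Local Notation H := (l2 R X).
Local Notation A := (uniform_roe X).

(** [c] is the inverse of [l2norm w]. The error doubles because normalizing moves [w] by
    [|l2norm w - 1| <= e]; the condition [e <= 1 / 2] keeps [l2norm w] at least 1/2, hence [normc c]
    at most 2. *)
Lemma approx_unit (v w : H) (e : R) : l2norm v = 1 -> l2norm (v - w) <= e -> e <= 1 / 2 ->
  exists c : R[i], [/\ l2norm (c *: w) = 1, l2norm (v - c *: w) <= 2 * e & normc c <= 2].
Proof.
move=> v1 vw e12.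
have w1 : 1 - e <= l2norm w.
  by have := l2normD (v - w) w; rewrite subrK v1; lra.
have w2 : l2norm w <= 1 + e.
  have := l2normD (w - v) v; rewrite subrK v1 l2normBC; lra.
have w0 : 0 < l2norm w by lra.
have nc (r : R) : 0 <= r -> normc (r%:C) = r.
  by move=> r0; rewrite normc_real ger0_norm.
exists ((l2norm w)^-1%:C); split.
- by rewrite l2normZ nc ?mulVf ?gt_eqF// invr_ge0 ltW.
- have -> : v - (l2norm w)^-1%:C *: w = (v - w) + (1 - (l2norm w)^-1%:C) *: w.
    by rewrite scalerBl scale1r addrA subrK.
  rewrite (le_trans (l2normD _ _))// l2normZ mulr_natl mulr2n lerD//.
  rewrite -(rmorph1 (real_complex R)) -rmorphB normc_real.
  rewrite -[X in _ * X]ger0_norm ?l2norm_ge0// -normrM mulrBl mul1r mulVf ?gt_eqF//.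
  by rewrite ler_norml; lra.
- rewrite nc; last by rewrite invr_ge0 ltW.
  rewrite -[leRHS]invrK lef_pV2 ?posrE//; lra.
Qed.

Variables (xi : nat -> H) (Phi : (nat -> R[i]) -> H -> H).
Hypotheses (hA : cstar_subalgebra A)
  (xi_on : forall m n, l2dot (xi m) (xi n) = (m == n)%:R)
  (xi_total : forall v, (forall n, l2dot v (xi n) = 0) -> v = 0)
  (PhiA : forall u, linfty u -> A (Phi u))
  (Phi_coef : forall u v n, linfty u -> l2dot (Phi u v) (xi n) = u n * l2dot v (xi n)).

Lemma xi_neq0 n : exists x, xi n x != 0.
Proof.
apply: contrapT => /forallNP h; have : xi n = 0.
  by apply: l2_ext => x; apply/eqP/negP => /negP/h.
move=> x0; have := xi_on n n; rewrite x0 l2dot0l eqxx => /eqP.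
by rewrite eq_sym oner_eq0.
Qed.

(** If the uniform lower bound fails, it fails arbitrarily far out: each [xi n] is nonzero, so a
    bound valid from [J] on extends to the finitely many earlier vectors at the price of a smaller
    [d]. *)
Lemma flat_dichotomy :
  (exists2 d : R, 0 < d & forall n, exists x, d <= normc (xi n x)) \/
  (forall (d : R) (J : nat), 0 < d -> exists n, (J <= n)%N /\ forall x, normc (xi n x) < d).
Proof.
have [|h] := pselect (exists (d : R) (J : nat), 0 < d /\
    forall n, (J <= n)%N -> exists x, d <= normc (xi n x)); last first.
  right=> d J d0; apply: contrapT => /forallNP h'; apply: h; exists d, J; split => // n Jn.
  apply: contrapT => /forallNP h''; apply: (h' n); split => // x.
  by rewrite ltNge; apply/negP/h''.
move=> [d [J]]; elim: J d => [|J IH] d [d0 hd].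
  by left; exists d => // n; exact: hd.
have [x x0] := xi_neq0 J; have nx : 0 < normc (xi J x).
  rewrite lt_neqAle normc_nonneg andbT eq_sym; apply: contraNneq x0.
  by move=> /eq0_normc ->.
apply: (IH (Num.min d (normc (xi J x)))); split; first by rewrite lt_min d0.
move=> n; rewrite leq_eqVlt => /orP[/eqP <-|/hd[y yd]].
  by exists x; rewrite ge_min lexx orbT.
by exists y; rewrite ge_min yd.
Qed.

Lemma spread_vector (F : {fset X}) (J : nat) (e : R) : 0 < e ->
  (forall (d : R) (J : nat), 0 < d -> exists n, (J <= n)%N /\ forall x, normc (xi n x) < d) ->
  exists n (Z : {fset X}), [/\ (J <= n)%N, [disjoint Z & F]%fset,
    forall x, normc (xi n x) <= e & l2norm (xi n - l2_chi [set` Z] (xi n)) <= e].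
Proof.
move=> e0 flat; pose d := e / 2 / (#|` F|%:R + 1).
have F1 : 0 < #|` F|%:R + 1 :> R by rewrite ltr_wpDl.
have d0 : 0 < d by rewrite !divr_gt0.
have [n [Jn nd]] := flat d J d0.
have [Y /(_ Y (fsubset_refl Y)) HY] := l2_tail (xi n) (divr_gt0 e0 (ltr0Sn R 1)).
exists n, (Y `\` F)%fset; split => //.
- by rewrite fdisjoint_sym; apply/fdisjointP => x xF; rewrite !inE xF.
- move=> x; rewrite (le_trans (ltW (nd x)))// /d ler_pdivrMr// ler_pdivrMr//.
  by rewrite -mulrA ler_peMr ?ltW//; have := ler0n R #|` F|; lra.
have -> : xi n - l2_chi [set` (Y `\` F)%fset] (xi n) =
    (xi n - l2_chi [set` Y] (xi n)) + l2_chi [set` (Y `&` F)%fset] (xi n).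
  apply: l2_ext => x; rewrite !(l2_addE, l2_oppE) !l2_chiE.
  have m (Z : {fset X}) : (x \in [set` Z]) = (x \in Z).
    by apply/idP/idP => [/set_mem//|h]; rewrite mem_set.
  by rewrite !m !inE; case: (x \in Y); case: (x \in F) => /=; ring.
rewrite (le_trans (l2normD _ _))// [X in _ <= X](splitr e) lerD//.
rewrite -(@ler_sqr R) ?nnegrE ?l2norm_ge0 ?divr_ge0 ?(ltW e0)//.
rewrite l2norm_eq_chi_fset (le_trans (le_sum_fset _ (fsubsetIr Y F)))//.
  by move=> x; exact: sqr_ge0.
rewrite (@le_trans _ _ (\sum_(x <- F) d ^+ 2))//.
  by apply: ler_sum => x _; rewrite ler_sqr ?nnegrE ?normc_nonneg ?(ltW d0)// (ltW (nd x)).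
rewrite big_const_seq count_predT iter_addr_0 -[X in X <= _]mulr_natl.
have -> : e / 2 = d * (#|` F|%:R + 1) by rewrite /d divfK// gt_eqF.
rewrite [leRHS]exprMn [leLHS]mulrC ler_wpM2l ?sqr_ge0//.
by move: (ler0n R #|` F|); move: (#|` F|%:R) => t t0; nra.
Qed.

(** The exponent is chosen so that [2 * (2 * eps k) = (1 / 2) ^+ k.+1], whose sums are at most 1:
    one factor 2 comes from normalizing in [approx_unit], the other from comparing rank one
    projections in [rank1_sub_le]. *)
Let eps (k : nat) : R := (1 / 2) ^+ (k + 3).

Let eps_gt0 k : 0 < eps k.
Proof. by rewrite exprn_gt0// divr_gt0. Qed.

Let eps_le k : eps k <= 1 / 8.
Proof.
have -> : 1 / 8 = (1 / 2) ^+ 3 :> R by field.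
by rewrite /eps exprD ler_piMl ?exprn_ge0 ?exprn_ile1//; lra.
Qed.

Lemma spread_sequence :
  (forall (d : R) (J : nat), 0 < d -> exists n, (J <= n)%N /\ forall x, normc (xi n x) < d) ->
  exists (nn : nat -> nat) (Z : nat -> {fset X}),
    [/\ forall j k, (j < k)%N -> (nn j < nn k)%N,
        forall j k, (j < k)%N -> [disjoint Z k & Z j]%fset,
        forall k x, normc (xi (nn k) x) <= eps k &
        forall k, l2norm (xi (nn k) - l2_chi [set` Z k] (xi (nn k))) <= eps k].
Proof.
move=> flat.
have /choice[st Hst] : forall t : nat * ({fset X} * nat), exists nZ : nat * {fset X},
    [/\ (t.2.2 <= nZ.1)%N, [disjoint nZ.2 & t.2.1]%fset,
    forall x, normc (xi nZ.1 x) <= eps t.1 &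
    l2norm (xi nZ.1 - l2_chi [set` nZ.2] (xi nZ.1)) <= eps t.1].
  move=> [k [F J]]; have [n [Z H]] := spread_vector F J (eps_gt0 k) flat.
  by exists (n, Z).
(* [s k] holds the union of the supports already used and the first index still allowed. *)
pose s := fix s k := if k is k'.+1 then
  ((s k').1 `|` (st (k', s k')).2, (st (k', s k')).1.+1)%fset else (fset0, 0%N).
pose nn k := (st (k, s k)).1; pose Z k := (st (k, s k)).2.
have nnS k : (nn k < nn k.+1)%N by have [h _ _ _] := Hst (k.+1, s k.+1).
have ZF j k : (j < k)%N -> (Z j `<=` (s k).1)%fset.
  elim: k => // k IH; rewrite ltnS leq_eqVlt => /orP[/eqP ->|/IH h] /=.
    exact: fsubsetUr.
  by rewrite (fsubset_trans h)// fsubsetUl.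
exists nn, Z; split.
- by move=> j k; apply: (homo_ltn ltn_trans nnS).
- move=> j k /ZF Zjk; have [_ h _ _] := Hst (k, s k).
  by apply: fdisjointWr h.
- by move=> k; have [_ _ h _] := Hst (k, s k).
- by move=> k; have [_ _ _ h] := Hst (k, s k).
Qed.

Lemma block_sequence :
  (forall (d : R) (J : nat), 0 < d -> exists n, (J <= n)%N /\ forall x, normc (xi n x) < d) ->
  exists (nn : nat -> nat) (Z : nat -> {fset X}) (eta : nat -> H),
    [/\ injective nn, forall j k, j != k -> [disjoint Z j & Z k]%fset,
        forall k x, x \notin Z k -> eta k x = 0,
        forall k x, normc (eta k x) <= 2 * eps k &
        forall k, l2norm (eta k) = 1 /\ l2norm (xi (nn k) - eta k) <= 2 * eps k].
Proof.
move=> /spread_sequence[nn [Z [nnlt Zdisj xisup xiZ]]].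
have nxi n : l2norm (xi n) = 1 by exact: l2norm_xi.
have /choice[c Hc] k := approx_unit (nxi (nn k)) (xiZ k) ltac:(have := eps_le k; lra).
exists nn, Z, (fun k => c k *: l2_chi [set` Z k] (xi (nn k))); split.
- move=> j k njk; have [/nnlt|/nnlt|//] := ltngtP j k; by rewrite njk ltnn.
- move=> j k; rewrite neq_ltn => /orP[/Zdisj|/Zdisj//].
  by rewrite fdisjoint_sym.
- by move=> k x xZ; rewrite l2_scaleE l2_chiE memNset ?mulr0//=; exact/negP.
- move=> k x; rewrite l2_scaleE normcM ler_pM ?normc_nonneg//; first by case: (Hc k).
  by rewrite l2_chiE; case: ifP => // _; rewrite normc0 ltW.
- by move=> k; have [h1 h2 _] := Hc k.
Qed.

Lemma rank1_sub_le (v w f : H) : l2norm v = 1 -> l2norm w = 1 ->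
  l2norm (l2dot f v *: v - l2dot f w *: w) <= 2 * l2norm (w - v) * l2norm f.
Proof.
move=> v1 w1.
have -> : l2dot f v *: v - l2dot f w *: w = l2dot f v *: (v - w) + l2dot f (v - w) *: w.
  by rewrite l2dotBr scalerBr scalerBl addrA subrK.
rewrite (le_trans (l2normD _ _))// !l2normZ w1 mulr1.
have h1 := cauchy_schwarz f v; have h2 := cauchy_schwarz f (v - w).
rewrite v1 mulr1 in h1; rewrite (l2normBC w v).
have h3 := ler_wpM2r (l2norm_ge0 (v - w)) h1.
by move: (l2norm_ge0 (v - w)) (l2norm_ge0 f) h2 h3; lra.
Qed.

Lemma ghost_projection :
  (forall (d : R) (J : nat), 0 < d -> exists n, (J <= n)%N /\ forall x, normc (xi n x) < d) ->
  exists p : H -> H, block_rank_one p /\ ghost p.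
Proof.
move=> /block_sequence[nn [Z [eta [nninj Zdisj etaZ etasup eta_xi]]]].
have eta1 k : l2norm (eta k) = 1 by case: (eta_xi k).
have etaD j k f : j != k -> l2dot (l2_chi [set` Z k] f) (eta j) = 0.
  move=> jk; apply: l2dot_disjoint => x; rewrite l2_chiE.
  case: ifPn => [/set_mem/= xk|_]; last by rewrite mul0r.
  rewrite etaZ ?conjC0 ?mulr0//; apply/negP => xj.
  by have /fdisjointP/(_ x xj) := Zdisj _ _ jk; rewrite xk.
have chieta k : l2_chi [set` Z k] (eta k) = eta k.
  apply: l2_ext => x; rewrite l2_chiE; case: ifPn => // /negP xZ.
  by rewrite etaZ//; apply/negP => h; apply: xZ; rewrite mem_set.
have eta_on j k : l2dot (eta j) (eta k) = (j == k)%:R.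
  case: eqVneq => [->|jk]; first by rewrite l2dot_self eta1 expr1n.
  by rewrite -(chieta j) etaD// eq_sym.
pose p := onproj eta.
have pbd : opbd 1 p by exact: onproj_opbd.
have pcoef f n : l2dot (p f) (eta n) = l2dot f (eta n) by exact: onproj_coef.
have pchi k f : l2_chi [set` Z k] (p (l2_chi [set` Z k] f)) = l2dot f (eta k) *: eta k.
  have -> : p (l2_chi [set` Z k] f) = p (l2dot f (eta k) *: eta k).
    apply: onproj_ext => // j; rewrite l2dotZl eta_on.
    have [->|jk] := eqVneq k j; last by rewrite etaD 1?eq_sym// mulr0.
    rewrite mulr1; apply/eqP; rewrite eq_sym -subr_eq0 -l2dotBl; apply/eqP.
    apply: l2dot_disjoint => x; rewrite l2_subE l2_chiE.
    case: ifPn => [_|/negP xZ]; first by rewrite subrr mul0r.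
    by rewrite etaZ ?conjC0 ?mulr0//; apply/negP => h; apply: xZ; rewrite mem_set.
  have [_ pl _] := pbd; rewrite (linZ pl) /p onproj_fix//.
  apply: l2_ext => x; rewrite l2_chiE !l2_scaleE; case: ifPn => // /negP xZ.
  by rewrite etaZ ?mulr0//; apply/negP => h; apply: xZ; rewrite mem_set.
(* Past the first [K] blocks, [p] is within [(1 / 2) ^+ K] of the projection onto the closed span of
   the [xi (nn (K + k))]. That projection is diagonal in [xi], hence equal to [Phi ind]; the first
   [K] blocks contribute the finite rank operator [fin]. *)
have Ap : A p.
  apply: (cstar_limit hA pbd) => e e0; have [K HK] := half_exp_small e0.
  pose ind m : R[i] := `[< exists k, m = nn (K + k)%N >]%:R.
  have lind : linfty ind.
    apply/linftyP; exists 1 => m; rewrite /ind; case: asboolP => _.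
      by rewrite normc1.
    by rewrite normc0.
  pose fin := \sum_(k <- iota 0 K) rank1 (eta k) (eta k).
  exists (Phi ind + fin).
    apply: (cstarD hA); first exact: PhiA.
    by apply: (cstar_sum hA) => k; exact: roe_rank1.
  move=> f; pose eta' k := eta (K + k)%N; pose xi' k := xi (nn (K + k)%N).
  have eta'_on j k : l2dot (eta' j) (eta' k) = (j == k)%:R by rewrite eta_on eqn_add2l.
  have xi'_on j k : l2dot (xi' j) (xi' k) = (j == k)%:R.
    by rewrite xi_on (inj_eq nninj) eqn_add2l.
  have finE : fin f = xi_partial eta K f by rewrite /fin fct_sumE.
  have psplit M : xi_partial eta (K + M) f = xi_partial eta K f + xi_partial eta' M f.
    rewrite /xi_partial iotaD big_cat add0n /=; congr (_ + _).
    by rewrite -[in LHS](addn0 K) iotaDl big_map.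
  have c1 : p f - fin f = onproj eta' f.
    apply/eqP; rewrite -subr_eq0; apply/eqP/l2norm_small0 => d d0.
    have d2 : 0 < d / 2 by rewrite divr_gt0.
    have [L1 H1] := onproj_cvg eta_on f d2; have [L2 H2] := onproj_cvg eta'_on f d2.
    have {}H1 := H1 (K + (L1 + L2))%N ltac:(lia); have {}H2 := H2 (L1 + L2)%N ltac:(lia).
    have -> : p f - fin f - onproj eta' f = (p f - xi_partial eta (K + (L1 + L2)) f) -
        (onproj eta' f - xi_partial eta' (L1 + L2) f).
      by rewrite finE psplit opprD opprB !addrA subrK.
    by rewrite (le_trans (l2normB _ _))// [X in _ <= X](splitr d) lerD.
  have c2 : Phi ind f = onproj xi' f.
    apply: (xi_coef_inj xi_total) => m; rewrite Phi_coef// /ind.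
    case: asboolP => [[k ->]|km]; first by rewrite mul1r (onproj_coef xi'_on).
    rewrite mul0r (onproj_orth xi'_on)// => k; rewrite xi_on.
    by case: eqP => // h; case: km; exists k.
  have -> : p f - (Phi ind + fin) f = onproj eta' f - onproj xi' f.
    by rewrite -c1 -c2 [(Phi ind + fin) f]/(Phi ind f + fin f) opprD addrA addrAC.
  apply: onproj_sub_le => // M.
  rewrite /xi_partial -sumrB (le_trans (l2norm_sum _ _))//.
  rewrite (@le_trans _ _ (\sum_(m <- iota 0 M) ((1 / 2) ^+ K * (1 / 2) ^+ m.+1 * l2norm f)))//.
    apply: ler_sum => m _; rewrite (le_trans (rank1_sub_le f (eta1 _) (l2norm_xi xi_on _)))//.
    rewrite ler_wpM2r ?l2norm_ge0//.
    have [_ h] := eta_xi (K + m)%N.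
    have -> : (1 / 2) ^+ K * (1 / 2) ^+ m.+1 = 2 * (2 * eps (K + m)) :> R.
      by rewrite /eps exprS !exprD; field.
    by rewrite ler_pM2l.
  rewrite -mulr_suml -mulr_sumr ler_wpM2r ?l2norm_ge0//.
  rewrite (le_trans _ HK)// ler_piMr ?exprn_ge0//.
  exact: geometric_sum_le.
exists p; split.
  split => //.
    split; first by apply/bounded_opP; exists 1.
      by apply/funext => f; exact: onproj_idem.
    apply: adj_unique; first by apply/bounded_opP; exists 1.
    by move=> f g; exact: onproj_sym.
  exists (fun k => [set` Z k]); split.
  - apply/trivIsetP => i j _ _ ij; apply/seteqP; split => // x /= [xi_ xj].
    by have /fdisjointP/(_ x xi_) := Zdisj _ _ ij; rewrite xj.
  - move=> k; split => //; apply/set0P/eqP => Z0.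
    have : l2norm (eta k) = 0.
      rewrite (_ : eta k = 0) ?l2norm0//; apply: l2_ext => x; apply: etaZ.
      by apply/negP => h; have : [set` Z k] x by []; rewrite Z0.
    by rewrite eta1 => /eqP; rewrite oner_eq0.
  - move=> f; under eq_fun do under eq_bigr do rewrite pchi.
    apply/cvgrPdist_le => e e0.
    have [r r0 er] : exists2 r : R, 0 < r & e = r%:C.
      exists (complex.Re e); last by rewrite RRe_real// gtr0_real.
      by move: e0; rewrite ltcE/= => /andP[].
    have [L HL] := onproj_cvg eta_on f r0; exists L => // M /= /HL h.
    rewrite er l2_normE lecR (le_trans _ h)// /xi_partial.
    by rewrite -(big_mkord xpredT (fun k => l2dot f (eta k) *: eta k)) /index_iota subn0.
  - move=> k; exists (eta k).
      by apply: contraPneq (eta1 k) => ->; rewrite l2norm0 => /eqP; rewrite eq_sym oner_eq0.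
    apply/seteqP; split=> f /=.
      by move=> [g _ <-]; exists (l2dot g (eta k)) => //; rewrite pchi.
    move=> [c _ <-]; exists (c *: eta k) => //; rewrite pchi.
    by rewrite l2dotZl eta_on eqxx mulr1.
split => // e e0; have e2 : 0 < e / 2 by rewrite divr_gt0.
have [K HK] := half_exp_small e2.
(* Off these blocks only the [eta m] with [K <= m] contribute to an entry, each by at most
   [(2 * eps m) ^+ 2]. The other half of [e] pays for truncating the expansion at [L]. *)
exists (\bigcup_(k in `I_K) [set` Z k]); first by apply: bigcup_finite.
move=> x z xA zA; rewrite norm_normc lecR /entry l2dot_delta.
have [L /(_ L (leqnn L)) HL] := onproj_cvg eta_on (l2_delta z) e2.
rewrite -(subrK (xi_partial eta L (l2_delta z)) (p (l2_delta z))) l2_addE.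
rewrite (le_trans (le_normcD _ _))// [X in _ <= X](splitr e) lerD//.
  by rewrite (le_trans (normc_le_l2norm _ _)).
rewrite /xi_partial l2_sumE (le_trans (normc_sum _ _))//.
rewrite (@le_trans _ _ (\sum_(m <- iota 0 L) ((1 / 2) ^+ K * (1 / 2) ^+ m.+1)))//; last first.
  rewrite -mulr_sumr (le_trans _ HK)// ler_piMr ?exprn_ge0//.
  exact: geometric_sum_le.
apply: ler_sum => m _; rewrite l2_scaleE normcM l2dot_deltal normc_conj.
have [mK|Km] := ltnP m K.
  rewrite (etaZ m x) ?normc0 ?mulr0 ?mulr_ge0 ?exprn_ge0//.
  by apply/negP => h; apply: xA; exists m.
rewrite (le_trans (ler_pM _ _ (etasup m z) (etasup m x))) ?normc_nonneg//.
have -> : 2 * eps m * (2 * eps m) = (1 / 2) ^+ (m + 3) * (1 / 2) ^+ m.+1 :> R.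
  by rewrite /eps exprS !exprD; field.
have h2 : 0 <= 1 / 2 :> R by lra.
by apply: ler_wpM2r; [exact: exprn_ge0|apply: ler_wiXn2l => //; [lra|lia]].
Qed.

Lemma uniformly_concentrated : ~ (exists p : H -> H, block_rank_one p /\ ghost p) ->
  exists2 d : R, 0 < d & forall n, exists x, d <= normc (xi n x).
Proof. by move=> h; case: flat_dichotomy => // /ghost_projection. Qed.
End GhostFree.

(** * Intertwining the basis with points of X *)

(* Baire category by hand: nested cylinders avoiding every [P r] would have a common point. *)
Lemma cylinder_category (P : nat -> (nat -> bool) -> Prop) :
  (forall th, exists r, P r th) ->
  exists r s, forall t, exists2 th : nat -> bool,
    (forall n, (n < size (s ++ t))%N -> th n = nth false (s ++ t) n) & P r th.
Proof.
move=> HP; apply: contrapT => h.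
have /choice[g Hg] : forall rs : nat * seq bool, exists t, forall th : nat -> bool,
    (forall n, (n < size (rs.2 ++ t))%N -> th n = nth false (rs.2 ++ t) n) -> ~ P rs.1 th.
  move=> [r s]; apply: contrapT => /forallNP h'; apply: h; exists r, s => t.
  by have /existsNP[th /not_implyP[h1 /contrapT h2]] := h' t; exists th.
(* The appended bit makes each prefix strictly longer even when [g] returns the empty list, so the
   nested cylinders determine an infinite sequence. *)
pose s := fix s r := if r is r'.+1 then s r' ++ rcons (g (r', s r')) true else [::].
have ss r : size (s r.+1) = (size (s r) + (size (g (r, s r))).+1)%N.
  by rewrite /= size_cat size_rcons.
have rs r : (r <= size (s r))%N by elim: r => // r IH; rewrite ss; lia.
have sn r r' n : (r <= r')%N -> (n < size (s r))%N -> nth false (s r') n = nth false (s r) n.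
  move=> /subnKC <-; elim: (r' - r)%N => [|k IH] nr; first by rewrite addn0.
  rewrite addnS /= nth_cat -IH// ifT//; apply: (leq_trans nr).
  by elim: k {IH} => [|k IH]; rewrite ?addn0// addnS ss; lia.
have [r Pr] := HP (fun n => nth false (s n.+1) n).
apply: (Hg (r, s r) _ _ Pr) => n /= nr.
have -> : nth false (s r ++ g (r, s r)) n = nth false (s r.+1) n.
  by rewrite /= -cats1 catA [RHS]nth_cat nr.
have nr1 : (n < size (s r.+1))%N by rewrite ss; move: nr; rewrite size_cat; lia.
have [h1|h1] := leqP r.+1 n.+1; first by rewrite -(sn _ _ _ h1)//.
by rewrite -(sn n.+1 r.+1 n)// ?(ltnW h1)//; exact: rs.
Qed.

Section Concentration.
Context {R : realType} {X : choiceType}.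
Local Notation H := (l2 R X).
Variables (xi : nat -> H) (f : nat -> X) (d : R).
Hypotheses (xi_on : forall m n, l2dot (xi m) (xi n) = (m == n)%:R)
  (d0 : 0 < d) (fd : forall n, d <= normc (xi n (f n))).

(** The colour [c n] counts the earlier indices with the same value of [f]. Bessel's inequality for
    the basis vector at [f n] bounds this count times [d ^+ 2] by 1. *)
Lemma finite_injective_partition : exists (N : nat) (c : nat -> nat),
  (forall n, (c n < N)%N) /\ (forall m n, c m = c n -> f m = f n -> m = n).
Proof.
pose c n := count (fun m => f m == f n) (iota 0 n).
have clt m n : (m < n)%N -> f m = f n -> (c m < c n)%N.
  move=> mn fmn; rewrite /c -fmn -(subnKC mn) addSnnS iotaD count_cat /= add0n eqxx.
  lia.
exists (Num.trunc (d ^+ 2)^-1).+1, c; split; last first.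
  by move=> m n cmn fmn; have [/clt/(_ fmn)|/clt/(_ (esym fmn))|//] := ltngtP m n; rewrite cmn ltnn.
move=> n; rewrite -(ltr_nat R); apply: le_lt_trans (truncnS_gt _).
rewrite -[leRHS]mul1r ler_pdivlMr ?exprn_gt0//.
have us : uniq [seq m <- iota 0 n | f m == f n] by rewrite filter_uniq ?iota_uniq.
have := bessel xi_on (l2_delta (f n)) us; rewrite l2norm_delta expr1n.
apply: le_trans; rewrite /c -size_filter -sum1_size natr_sum mulr_suml.
rewrite !big_filter; apply: ler_sum => m /eqP <-.
by rewrite mul1r l2dot_deltal normc_conj ler_sqr ?nnegrE ?normc_nonneg ?(ltW d0).
Qed.
End Concentration.

Section Intertwiner.
Context {R : realType} {X : choiceType}.
Local Notation H := (l2 R X).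
Variables (xi : nat -> H) (f : nat -> X) (M : pred nat).
Hypotheses (xi_on : forall m n, l2dot (xi m) (xi n) = (m == n)%:R)
  (f_inj : forall m n, M m -> M n -> f m = f n -> m = n).

Definition in_image (x : X) : bool := `[< exists n, M n /\ f n = x >].
Definition preim_index (x : X) : nat := xget 0%N [set n | M n /\ f n = x].

Lemma preim_indexP x : in_image x -> M (preim_index x) /\ f (preim_index x) = x.
Proof. by move=> /asboolP[n h]; rewrite /preim_index; case: xgetP => [m _ //|/(_ n)]. Qed.

Lemma in_image_f n : M n -> in_image (f n).
Proof. by move=> Mn; apply/asboolP; exists n. Qed.

Lemma preim_index_f n : M n -> preim_index (f n) = n.
Proof. by move=> Mn; have [h1 h2] := preim_indexP (in_image_f Mn); exact: f_inj. Qed.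

(* The partial isometry [xi n |-> delta_(f n)], for [n] in [M], and [0] on the other [xi n]. *)
Definition intertwiner (v : H) : H :=
  to_l2 (fun x => if in_image x then l2dot v (xi (preim_index x)) else 0).

Lemma intertwiner_sum_le v (Y : {fset X}) :
  \sum_(x <- Y) normc (if in_image x then l2dot v (xi (preim_index x)) else 0) ^+ 2
    <= (1 * l2norm v) ^+ 2.
Proof.
have us : uniq [seq preim_index x | x <- [seq x <- Y | in_image x]].
  rewrite map_inj_in_uniq ?filter_uniq ?fset_uniq// => x y.
  rewrite !mem_filter => /andP[/preim_indexP[_ hx] _] /andP[/preim_indexP[_ hy] _] xy.
  by rewrite -hx -hy xy.
have := bessel xi_on v us; rewrite mul1r; apply: le_trans.
rewrite big_map big_filter (bigID (fun x => in_image x))/=.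
rewrite [X in _ + X]big1 => [|x /negbTE ->]; last by rewrite normc0 expr0n.
by rewrite addr0; apply: ler_sum => x ->.
Qed.

Lemma intertwinerE v x : intertwiner v x =
  if in_image x then l2dot v (xi (preim_index x)) else 0.
Proof. by rewrite /intertwiner (to_l2E (intertwiner_sum_le v)). Qed.

Lemma intertwiner_f v n : M n -> intertwiner v (f n) = l2dot v (xi n).
Proof. by move=> Mn; rewrite intertwinerE in_image_f// preim_index_f. Qed.

Lemma intertwiner_opbd : opbd 1 intertwiner.
Proof.
split=> // [c v w|v].
  apply: l2_ext => x; rewrite l2_addE l2_scaleE !intertwinerE.
  by case: ifP => _; rewrite ?l2dotDl ?l2dotZl// mulr0 addr0.
apply: l2norm_le_sum => [|Y]; first by rewrite mul1r l2norm_ge0.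
by under eq_bigr do rewrite intertwinerE; exact: intertwiner_sum_le.
Qed.

Lemma intertwiner_xi n : intertwiner (xi n) = if M n then l2_delta (f n) else 0.
Proof.
apply: l2_ext => x; rewrite intertwinerE; case: ifPn => [xM|xM].
  have [Mi fi] := preim_indexP xM; rewrite xi_on.
  have [ni|ni] := eqVneq n (preim_index x).
    by rewrite ni Mi l2_deltaE fi eqxx.
  case: ifP => // Mn; rewrite l2_deltaE; case: eqVneq => // xf.
  by move: ni; rewrite xf preim_index_f// eqxx.
case: ifPn => // Mn; rewrite l2_deltaE; case: eqVneq => // xf.
by move: xM; rewrite xf in_image_f.
Qed.

(** Multiplying [v] by a function [g] on [X] multiplies the coefficient of index [n] by [g (f n)]:
    this is how functions on [X] turn into elements of [B]. *)
Lemma adj_intertwiner_coef v n :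
  l2dot (adj intertwiner v) (xi n) = if M n then v (f n) else 0.
Proof.
rewrite l2dotC -(adjP _ _ intertwiner_opbd) intertwiner_xi.
by case: ifP => _; rewrite ?l2dot0l ?conjC0// l2dot_deltal conjCK.
Qed.
End Intertwiner.

Section IntertwinerInRoe.
Context {R : realType} {X : metricType R}.
Local Notation H := (l2 R X).
Local Notation A := (uniform_roe X).
Variables (xi : nat -> H) (Phi : (nat -> R[i]) -> H -> H).
Hypotheses (hA : cstar_subalgebra A)
  (xi_on : forall m n, l2dot (xi m) (xi n) = (m == n)%:R)
  (xi_total : forall v, (forall n, l2dot v (xi n) = 0) -> v = 0)
  (PhiA : forall u, linfty u -> A (Phi u))
  (Phi_coef : forall u v n, linfty u -> l2dot (Phi u v) (xi n) = u n * l2dot v (xi n)).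

Lemma Phi_opbd u (k : R) : 0 <= k -> (forall n, normc (u n) <= k) -> opbd k (Phi u).
Proof.
move=> k0 uk; have lu : linfty u by apply/linftyP; exists k.
have [C [_ lPu _]] := cstar_bd hA (PhiA lu); split => // v.
apply: (le_xi_coef xi_on xi_total) => // n.
by rewrite Phi_coef// normcM ler_wpM2r ?normc_nonneg.
Qed.

Lemma Phi_xi u n : linfty u -> Phi u (xi n) = u n *: xi n.
Proof.
move=> lu; apply: (xi_coef_inj xi_total) => m; rewrite Phi_coef// l2dotZl xi_on.
by case: eqVneq => [->//|]; rewrite !mulr0.
Qed.

(** The error depends on [u] only through its bound [k], so one truncation index serves all choices
    of signs at once. *)
Lemma Phi_entry_approx u (k : R) L x z : 0 <= k -> (forall n, normc (u n) <= k) ->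
  normc (Phi u (l2_delta z) x - \sum_(n <- iota 0 L) u n * ((xi n z)^* * xi n x))
    <= k * l2norm (l2_delta z - xi_partial xi L (l2_delta z)).
Proof.
move=> k0 uk; have lu : linfty u by apply/linftyP; exists k.
have [_ lPu Pk] := Phi_opbd k0 uk; apply: le_trans (Pk _).
rewrite (linB lPu); apply: le_trans (normc_le_l2norm _ x).
rewrite l2_subE /xi_partial (lin_sum lPu) l2_sumE.
rewrite le_eqVlt; apply/orP; left; apply/eqP; congr (normc (_ - _)).
apply: eq_bigr => n _; rewrite (linZ lPu) Phi_xi// scalerA l2_scaleE l2dot_deltal.
by ring.
Qed.

Variables (f : nat -> X) (M : pred nat) (d : R).
Hypotheses (f_inj : forall m n, M m -> M n -> f m = f n -> m = n)
  (d0 : 0 < d) (fd : forall n, d <= normc (xi n (f n))).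

Let C := d^-1.
Let C0 : 0 <= C. Proof. by rewrite invr_ge0 ltW. Qed.

Let sg (b : bool) : R[i] := (-1) ^+ b.

Let normc_sg b : normc (sg b) = 1.
Proof. by rewrite /sg; case: b; rewrite ?expr0 ?expr1 ?normcN normc1. Qed.

Let xif0 n : xi n (f n) != 0.
Proof.
by apply: contraTneq (lt_le_trans d0 (fd n)) => ->; rewrite normc0 ltxx.
Qed.

(** Dividing by [xi n (f n)] makes the diagonal term of row [f n] equal to [(xi n z)^*], the entry
    of the intertwiner; the lower bound [d] keeps the weights bounded. *)
Definition sign_weight (th : nat -> bool) n : R[i] :=
  if M n then sg (th n) / xi n (f n) else 0.

Definition sign_mask (th : nat -> bool) x : R[i] :=
  if in_image f M x then sg (th (preim_index f M x)) else 0.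

(* If the signs are independent, the mean of [sign_op] is the intertwiner: the diagonal
   products of signs are 1 and the off-diagonal ones average to 0. *)
Definition sign_op th : H -> H := mulop (sign_mask th) \o Phi (sign_weight th).

Lemma sign_weight_le th n : normc (sign_weight th n) <= C.
Proof.
rewrite /sign_weight; case: ifP => _; last by rewrite normc0.
rewrite normcM normc_sg mul1r normcV lef_pV2 ?posrE//.
exact: lt_le_trans d0 (fd n).
Qed.

Lemma sign_mask_cbd th : cbd (sign_mask th) 1.
Proof. by move=> x; rewrite /sign_mask; case: ifP => _; rewrite ?normc_sg// normc0. Qed.

Lemma sign_op_roe th : A (sign_op th).
Proof.
apply: (cstarM hA); first exact: roe_mulop (sign_mask_cbd th).
by apply: PhiA; apply/linftyP; exists C; exact: sign_weight_le.
Qed.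

Lemma sign_op_opbd th : opbd C (sign_op th).
Proof.
rewrite -[C]mul1r; apply: opbd_comp; first exact: mulop_opbd (sign_mask_cbd th).
by apply: Phi_opbd => //; exact: sign_weight_le.
Qed.

Section Averages.
Variables (e : R) (r : nat).
Hypothesis e0 : 0 < e.

(** With [e] and [r] fixed the condition is convex, so averaging costs neither precision nor
    propagation. The bound on [b] makes ultralimits of the approximants available. *)
Definition near_finprop (V : H -> H) : Prop := opbd C V /\
  exists b, [/\ opbd (C + e) b, prop_le r%:R b &
    forall v, l2norm (V v - b v) <= e * l2norm v].

Definition average (V W : H -> H) : H -> H := (2^-1 : R[i]) *: (V + W).

Lemma normc_half : normc (2^-1 : R[i]) = 2^-1.
Proof. by rewrite -(rmorph_nat (real_complex R)) -fmorphV normc_real ger0_norm ?invr_ge0. Qed.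

Lemma average_opbd K V W : opbd K V -> opbd K W -> opbd K (average V W).
Proof.
move=> KV KW; have := opbdZ 2^-1 (opbdD KV KW); rewrite normc_half.
by rewrite [X in opbd X _](_ : _ = K)//; field.
Qed.

Lemma near_finprop_average V W : near_finprop V -> near_finprop W -> near_finprop (average V W).
Proof.
move=> [CV [b [Cb rb Vb]]] [CW [c [Cc rc Wc]]]; split; first exact: average_opbd.
exists (average b c); split; first exact: average_opbd.
  by apply: prop_leZ; exact: prop_leD.
move=> v; rewrite [average V W v]/(2^-1 *: (V v + W v)) [average b c v]/(2^-1 *: (b v + c v)).
rewrite -scalerBr opprD addrACA l2normZ normc_half ler_pdivrMl//.
rewrite mulr_natl mulr2n (le_trans (l2normD _ _))// lerD//.
Qed.

(** For [m] in [M], the coefficient of [sg (th m) * sg (th n)] in row [f m] and column [z] of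
    [sign_op th]. *)
Definition dyad z m n : R[i] := if M n then (xi n z)^* * xi n (f m) / xi n (f n) else 0.

(* Conditional expectation of the (f m, z) entry of [sign_op th] for uniformly random
   signs, given that [th] starts with [s]. *)
Definition mean_entry (s : seq bool) (m : nat) z : R[i] :=
  if (m < size s)%N then
    sg (nth false s m) * \sum_(n <- iota 0 (size s)) sg (nth false s n) * dyad z m n
  else dyad z m m.

(** One more sign is revealed, that of index [size s]. For an earlier [m] it adds a term of mean 0;
    for a later [m] nothing changes; for [m = size s] it squares to 1 in the diagonal term and
    averages the other terms to 0. *)
Lemma mean_entry_rcons s m z : mean_entry s m z =
  2^-1 * (mean_entry (rcons s false) m z + mean_entry (rcons s true) m z).
Proof.
have two : 2 != 0 :> R[i] by rewrite pnatr_eq0.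
have E b : \sum_(n <- iota 0 (size s).+1) sg (nth false (rcons s b) n) * dyad z m n =
    \sum_(n <- iota 0 (size s)) sg (nth false s n) * dyad z m n + sg b * dyad z m (size s).
  rewrite -addn1 iotaD big_cat /= big_seq1 add0n nth_rcons ltnn eqxx; congr (_ + _).
  by apply: eq_big_seq => n; rewrite mem_iota add0n => /andP[_ ns]; rewrite nth_rcons ns.
rewrite /mean_entry !size_rcons !E !nth_rcons; set S := \sum_(n <- _) _.
have [ms|ms|->] := ltngtP m (size s).
- by rewrite ltnS (ltnW ms) /sg expr0 expr1; field.
- by rewrite ltnS leqNgt ms /=; field.
- by rewrite ltnSn /sg expr0 expr1; field.
Qed.

Let tail L z := l2norm (l2_delta z - xi_partial xi L (l2_delta z)).

(** [V] averages [2 ^ K] operators [sign_op th], one for each extension of [s] by [K] bits. Density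
    provides only some [th] in each cylinder; its uncontrolled later signs are absorbed by the tail
    of the basis vector at [z]. *)
Lemma sign_average s : 
  (forall t, exists2 th : nat -> bool,
    (forall n, (n < size (s ++ t))%N -> th n = nth false (s ++ t) n) &
    near_finprop (sign_op th)) ->
  forall K, exists V, [/\ near_finprop V,
    (forall x z, ~~ in_image f M x -> V (l2_delta z) x = 0) &
    forall m z, M m -> (m < size s + K)%N ->
      normc (V (l2_delta z) (f m) - mean_entry s m z) <= C * tail (size s + K) z].
Proof.
move=> dense K; suff H0 t : exists V, [/\ near_finprop V,
    (forall x z, ~~ in_image f M x -> V (l2_delta z) x = 0) &
    forall m z, M m -> (m < size (s ++ t) + K)%N ->
      normc (V (l2_delta z) (f m) - mean_entry (s ++ t) m z) <= C * tail (size (s ++ t) + K) z].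
  by have := H0 [::]; rewrite cats0.
elim: K t => [|K IH] t.
  have [th th_s nth_] := dense t; exists (sign_op th); split => // [x z xM|m z Mm].
    rewrite /sign_op /= (mulopE _ _ (sign_mask_cbd th)) /sign_mask (negbTE xM).
    by rewrite mul0r.
  rewrite addn0 => ms; rewrite /sign_op /= (mulopE _ _ (sign_mask_cbd th)).
  rewrite /sign_mask in_image_f// preim_index_f// /mean_entry ms -(th_s _ ms).
  rewrite -mulrBr normcM normc_sg mul1r.
  apply: le_trans (Phi_entry_approx _ _ _ C0 (sign_weight_le th)).
  rewrite le_eqVlt; apply/orP; left; apply/eqP; congr (normc (_ - _)).
  apply: eq_big_seq => n; rewrite mem_iota add0n => /andP[_ ns].
  rewrite -(th_s _ ns) /dyad /sign_weight; case: ifP => _; last by rewrite mulr0 mul0r.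
  by field.
have [V0 [nV0 V0x V0m]] := IH (rcons t false); have [V1 [nV1 V1x V1m]] := IH (rcons t true).
exists (average V0 V1); split.
- exact: near_finprop_average.
- move=> x z xM; rewrite [average _ _ _]/(2^-1 *: (V0 _ + V1 _)) l2_scaleE l2_addE.
  by rewrite V0x// V1x// addr0 mulr0.
move=> m z Mm; rewrite addnS => mL.
have {V0m} := V0m m z Mm; have {V1m} := V1m m z Mm.
rewrite -!rcons_cat !size_rcons addSn => /(_ mL) h1 /(_ mL) h0.
rewrite mean_entry_rcons [average _ _ _]/(2^-1 *: (V0 _ + V1 _)) l2_scaleE l2_addE.
rewrite -mulrBr opprD addrACA normcM normc_half ler_pdivrMl// mulr_natl mulr2n.
by rewrite (le_trans (le_normcD _ _))// lerD.
Qed.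
End Averages.

Lemma intertwiner_roe : A (intertwiner xi f M).
Proof.
have Wbd : opbd 1 (intertwiner xi f M) by exact: intertwiner_opbd.
apply: (cstar_limit hA Wbd) => e e0.
have [r [s dense]] : exists r s, forall t, exists2 th : nat -> bool,
    (forall n, (n < size (s ++ t))%N -> th n = nth false (s ++ t) n) &
    near_finprop e r (sign_op th).
  apply: cylinder_category => th; have [_ /(_ e e0)] := (roeP _).1 (sign_op_roe th).
  move=> [n [K [b [bK nb hb]]]]; exists n; split; first exact: sign_op_opbd.
  exists b; split => //; have [K0 lb _] := bK; split => //; first by rewrite addr_ge0// ltW.
  move=> v; have [_ _ hT] := sign_op_opbd th.
  have -> : b v = sign_op th v - (sign_op th v - b v) by rewrite opprB addrC subrK.
  by rewrite (le_trans (l2normB _ _))// mulrDl lerD.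
have /choice[V HV] := sign_average dense.
pose l := size s.
pose ch x : R[i] := (in_image f M x && (l <= preim_index f M x)%N)%:R.
have ch1 : cbd ch 1 by move=> x; rewrite /ch; case: (_ && _); rewrite ?normc1 ?normc0.
have /choice[b Hb] : forall K, exists b, [/\ opbd (C + e) b, prop_le r%:R b &
    forall v, l2norm (V K v - b v) <= e * l2norm v].
  by move=> K; have [[_ h] _ _] := HV K.
have Vbd K : opbd C (V K) by have [[h _] _ _] := HV K.
have chbd : opbd 1 (mulop ch) by exact: mulop_opbd.
pose V' K := mulop ch \o V K; pose b' K := mulop ch \o b K.
have V'bd K : opbd C (V' K) by rewrite -[C]mul1r; exact: opbd_comp.
have b'bd K : opbd (C + e) (b' K).
  by rewrite -[C + e]mul1r; apply: opbd_comp => //; case: (Hb K).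
(* In row [f m] with [l <= m] the mean entry is [dyad z m m], which is the entry of the intertwiner,
   and the tail of the basis vector at [z] tends to 0. *)
have W'E : ulimop V' = mulop ch \o intertwiner xi f M.
  apply: (opbd_ext (ulimop_opbd V'bd) (opbd_comp chbd Wbd)) => z; apply: l2_ext => x.
  rewrite /ulimop (ulimvE (k := C * l2norm (l2_delta z)))/=; last by move=> n; case: (V'bd n).
  rewrite (mulopE _ _ ch1) intertwinerE//.
  apply: ulim_cvg => t t0; case: ifPn => [xM|xM]; last first.
    exists 0%N => n _; rewrite /V' /= (mulopE _ _ ch1).
    by have [_ h _] := HV n; rewrite h// !mulr0 subrr normc0 ltW.
  have [Mp fp] := preim_indexP xM; set m := preim_index f M x in Mp fp *.
  have Ct : 0 < t / (C + 1) by rewrite divr_gt0// ltr_wpDl.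
  have [L HL] := xi_expansion xi_on xi_total (l2_delta z) Ct.
  exists (L + m.+1)%N => n nL; rewrite /V' /= (mulopE _ _ ch1) -mulrBr.
  rewrite normcM {1}/ch xM /= -/m; have [lm|lm] := leqP l m; last first.
    by rewrite normc0 mul0r ltW.
  rewrite normc1 mul1r.
  have [_ _ /(_ m z Mp)] := HV n; rewrite fp.
  have -> : mean_entry s m z = dyad z m m by rewrite /mean_entry ltnNge lm.
  move=> h.
  have -> : l2dot (l2_delta z) (xi m) = dyad z m m.
    by rewrite /dyad Mp l2dot_deltal mulfK.
  apply: le_trans (h _) _; first by lia.
  rewrite (le_trans (ler_wpM2l C0 (HL _ _)))//; first by lia.
  by rewrite mulrA ler_pdivrMr ?ltr_wpDl// mulrC ler_pM2l// lerDl.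
(* An entry beyond distance [r] is 0 for every [n], hence in the ultralimit; here the common
   propagation bound pays off. *)
have b'prop : prop_le r%:R (ulimop b').
  move=> x z; apply: contraNT => zx.
  rewrite /ulimop (ulimvE (k := (C + e) * l2norm (l2_delta z)))/=; last by move=> n; case: (b'bd n).
  apply/eqP/ulim_cvg => t t0; exists 0%N => n _; rewrite subr0.
  have -> : b' n (l2_delta z) x = 0; last by rewrite normc0 ltW.
  apply/eqP; apply: contraNT zx; apply: (prop_le_mulop ch1).
  by case: (Hb n).
have b'A : A (ulimop b') by apply: roe_finprop b'prop; exact: ulimop_opbd.
pose fin := \sum_(m <- iota 0 l) (if M m then rank1 (l2_delta (f m)) (xi m) else 0).
have finA : A fin.
  by apply: (cstar_sum hA) => m; case: ifP => _; [exact: roe_rank1|exact: cstar0].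
exists (ulimop b' + fin); first exact: (cstarD hA).
move=> v; have -> : intertwiner xi f M v = ulimop V' v + fin v.
  rewrite W'E; apply: l2_ext => x; rewrite l2_addE /= (mulopE _ _ ch1) intertwinerE//.
  rewrite /fin fct_sumE l2_sumE /ch; case: ifPn => [xM|xM]; last first.
    rewrite mulr0 add0r big1// => m _; case: ifPn => // Mm.
    rewrite /rank1 l2_scaleE l2_deltaE; case: eqVneq => [xf|]; last by rewrite mulr0.
    by rewrite xf in_image_f in xM.
  have [Mp fp] := preim_indexP xM; set m := preim_index f M x in Mp fp *.
  have [lm|lm] := leqP l m.
    rewrite mul1r big1_seq ?addr0// => k /andP[_]; rewrite mem_iota add0n => /andP[_ kl].
    case: ifPn => // Mk; rewrite /rank1 l2_scaleE l2_deltaE; case: eqVneq => [xf|]; last by rewrite mulr0.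
    by move: lm; rewrite /m xf preim_index_f// leqNgt kl.
  rewrite mul0r add0r (bigD1_seq m) ?iota_uniq//=; last by rewrite mem_iota.
  rewrite Mp /rank1 l2_scaleE l2_deltaE fp eqxx mulr1 big1 ?addr0// => k km.
  case: ifPn => // Mk; rewrite l2_scaleE l2_deltaE; case: eqVneq => [xf|]; last by rewrite mulr0.
  by move: km; rewrite /m xf preim_index_f// eqxx.
have -> : ulimop V' v + fin v - (ulimop b' + fin) v = ulimop V' v - ulimop b' v.
  change (ulimop V' v + fin v - (ulimop b' v + fin v) = ulimop V' v - ulimop b' v).
  move: (ulimop V' v) (ulimop b' v) (fin v) => p q t.
  by rewrite opprD addrACA subrr addr0.
apply: ulimop_sub_le V'bd b'bd _ => n.
have [_ lch _] := chbd; rewrite /V' /b' /= -(linB lch).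
have [_ _ h] := chbd; rewrite (le_trans (h _))// mul1r.
by case: (Hb n).
Qed.
End IntertwinerInRoe.

(** * Generation by [B], the adjoint intertwiners and the shifts of integer radius *)

Theorem theorem1p7 (R : realType) (X : metricType R)
    (B : set (l2 R X -> l2 R X)) :
  uniformly_locally_finite X ->
  ~ (exists p : l2 R X -> l2 R X, block_rank_one p /\ ghost p) ->
  cartan_masa (uniform_roe X) B -> iso_linfty B ->
  co_separable (uniform_roe X) B.
Proof.
move=> ulf noghost hB hL; have hA := roe_cstar hB.
have BA : B `<=` uniform_roe X by case: hB => _ [].
have [xi [Phi [xi_on xi_total PhiP]]] := diagonal_basis hB hL.
have PhiB u : linfty u -> B (Phi u) by move=> /PhiP[].
have PhiA u : linfty u -> uniform_roe X (Phi u) by move=> /PhiB/BA.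
have Phi_coef u v n : linfty u -> l2dot (Phi u v) (xi n) = u n * l2dot v (xi n).
  by move=> /PhiP[].
have [d d0 /choice[f fd]] :=
  uniformly_concentrated hA xi_on xi_total PhiA Phi_coef noghost.
have [N [c [cN c_inj]]] := finite_injective_partition xi_on d0 fd.
pose M i : pred nat := fun n => c n == i.
have f_inj i m n : M i m -> M i n -> f m = f n -> m = n.
  by move=> /eqP mi /eqP ni; apply: c_inj; rewrite mi ni.
pose W i := intertwiner xi f (M i).
have Wbd i : opbd 1 (W i) by exact: intertwiner_opbd.
have Wcoef i v n : l2dot (adj (W i) v) (xi n) = if M i n then v (f n) else 0.
  exact: (adj_intertwiner_coef xi_on (f_inj i)).
have WA i : uniform_roe X (W i).
  exact: (intertwiner_roe hA xi_on xi_total PhiA Phi_coef (f_inj i) d0 fd).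
have /choice[card Hcard] : forall k : nat, exists n, forall x : X,
    (ball x k.+1%:R #<= `I_n)%card.
  by move=> k; apply: ulf; rewrite ltr0n.
pose gen (t : nat + nat * nat) : l2 R X -> l2 R X := match t with
  | inl i => adj (W i)
  | inr (k, j) => shiftop k.+1%:R j
  end.
pose S := range gen.
have SA : S `<=` uniform_roe X.
  move=> _ [[i|[k j]] _ <-] /=; first exact: (cstar_adj hA).
  have k0 : 0 < k.+1%:R :> R by rewrite ltr0n.
  apply: roe_finprop (prop_le_shiftop (Hcard k) k0).
  exact: (shiftop_opbd (Hcard k)).
have BSA : B `|` S `<=` uniform_roe X by move=> a [/BA|/SA].
exists S; split => //.
  exact: (card_le_trans (card_image_le gen setT) (countableP _)).
set G := cstar_gen (B `|` S).
have hG : cstar_subalgebra G.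
  by apply: cstar_gen_cstar => a /BSA; case: hA => -[h _ _ _ _] _; exact: h.
have BG : B `<=` G by move=> a Ba D [_]; apply; left.
have SG : S `<=` G by move=> a Sa D [_]; apply; right.
apply/seteqP; split=> a; last by apply; split.
move=> Aa; have [K aK] := cstar_bd hA Aa.
have resolution v : \sum_(i < N) adj (W i) (W i v) = v.
  apply: (xi_coef_inj xi_total) => n; rewrite l2dot_suml.
  under eq_bigr do rewrite Wcoef.
  have Mc : M (c n) n by exact: eqxx.
  rewrite (bigD1 (Ordinal (cN n)))//= Mc /W (intertwiner_f xi_on (f_inj (c n)) _ Mc).
  rewrite big1 ?addr0// => i ni; rewrite /M ifF//; apply/negbTE.
  by apply: contra ni => /eqP h; apply/eqP/val_inj.
have finprop_in_G i n C b : opbd C b -> prop_le n%:R b -> G (adj (W i) \o b).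
  move=> bC nb.
  have n0 : 0 < n.+1%:R :> R by rewrite ltr0n.
  have nn : n%:R < n.+1%:R :> R by rewrite ltr_nat.
  have [g [gC ->]] := finprop_decomposition (Hcard n) n0 nn bC nb.
  (* The element of [B] that replaces [mulop (g k)] is [Phi (g k \o f)]: by [Wcoef] both sides have
     the same coefficients in the basis [xi]. *)
  have -> : adj (W i) \o (\sum_(k < card n) (mulop (g k) \o @shiftop R X n.+1%:R k)) =
      \sum_(k < card n) (Phi (g k \o f) \o (adj (W i) \o @shiftop R X n.+1%:R k)).
    have [_ lW _] := adj_opbd (Wbd i).
    apply/funext => v; rewrite /= !fct_sumE (lin_sum lW); apply: eq_bigr => k _ /=.
    apply: (xi_coef_inj xi_total) => m; rewrite Phi_coef; last first.
      by apply/linftyP; exists C => j; exact: gC.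
    rewrite !Wcoef (mulopE _ _ (gC k)).
    by case: ifP => _; rewrite ?mulr0.
  apply: (cstar_sum hG) => k; apply: (cstarM hG).
    by apply: BG; apply: PhiB; apply/linftyP; exists C => j; exact: gC.
  apply: (cstarM hG); apply: SG; first by exists (inl i).
  by exists (inr (n, nat_of_ord k)).
apply: (cstar_limit hG aK) => e e0.
have N1 : 0 < N%:R + 1 :> R by rewrite ltr_wpDl.
have e1 : 0 < e / (N%:R + 1) by rewrite divr_gt0.
have /choice[b Hb] : forall i, exists b : l2 R X -> l2 R X, G (adj (W i) \o b) /\
    forall v, l2norm (W i (a v) - b v) <= e / (N%:R + 1) * l2norm v.
  move=> i; have [_ /(_ _ e1)[n [C [b [bC nb ab]]]]] := (roeP _).1 (cstarM hA (WA i) Aa).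
  by exists b; split => //; exact: (finprop_in_G _ _ _ _ bC nb).
exists (\sum_(i < N) (adj (W i) \o b i)); first by apply: (cstar_sum hG) => i; case: (Hb i).
move=> v; rewrite -{1}(resolution (a v)) fct_sumE -sumrB.
rewrite (le_trans (l2norm_sum _ _))//.
rewrite (@le_trans _ _ (\sum_(i < N) (e / (N%:R + 1) * l2norm v)))//.
  apply: ler_sum => i _; have [_ lW Wle] := adj_opbd (Wbd i).
  by rewrite /= -(linB lW) (le_trans (Wle _))// mul1r; case: (Hb i).
rewrite sumr_const card_ord -[leLHS]mulr_natl mulrA ler_wpM2r ?l2norm_ge0//.
by rewrite mulrCA ler_piMr ?(ltW e0)// ler_pdivrMr// mul1r lerDl.
Qed.
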